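(* Let $(V,h)$ be an oriented real quadratic vector space of signature $(p,p)$, $p\ge2$, let $(\Sigma,\gamma)$ be an irreducible real Clifford module for $(V^*,h^* )$ equipped with an admissible bilinear pairing, let $\xi\in\Sigma^\mu$ be an irreducible real pure spinor of chirality $\mu\in\{\pm1\}$, and let $\alpha=\theta_1\wedge\cdots\wedge\theta_p$ ($\theta_i\in V^*$) be its signed square. Let $\varphi\in V^*$ and $H\in\Lambda^3V^*$. (1) If $p\geq3$, then $\varphi\cdot\xi=H\cdot\xi$ if and only if $$H\wedge\alpha=0,\qquad \varphi\wedge\alpha=H\triangle_1\alpha.$$ (2) If $p=2$, then $\varphi\cdot\xi=H\cdot\xi$ if and only if $$(\varphi+\mu*H)\wedge\alpha=0.$$
   Context: $h^*$ is the metric on $V^*$ dual to $h$; $\theta^\sharp\in V$ is the $h$-dual of $\theta\in V^*$; $\langle-,-\rangle$ is the induced metric on $\Lambda V^*$ (determinant convention); $\nu$ is the pseudo-Riemannian volume form; the Hodge star is given by $\beta\wedge *\delta=\langle\beta,\delta\rangle\nu$. For a basis $\{e_i\}$ of $V$ with inverse metric matrix $h^{ij}$, $\beta\triangle_1\delta=h^{ij}(\iota_{e_i}\beta)\wedge(\iota_{e_j}\delta)$. The real Clifford algebra $\mathrm{Cl}(V^*,h^* )$ satisfies $\theta^2=h^*(\theta,\theta)$. It is identified via the Chevalley-Riesz isomorphism $\Psi:(\Lambda V^*,\diamond)\to\mathrm{Cl}(V^*,h^* )$ (identity on $V^*$) with $\Lambda V^*$ equipped with the geometric product $\diamond$, the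 associative product determined by $\theta\diamond\beta=\theta\wedge\beta+\iota_{\theta^\sharp}\beta$ for $\theta\in V^*$. In signature $(p,p)$ there is a unique irreducible real left module $\gamma:\mathrm{Cl}(V^*,h^* )\to\mathrm{End}(\Sigma)$, $\dim\Sigma=2^p$, and $\gamma$ is an isomorphism. Put $\Psi_\gamma=\gamma\circ\Psi$ and $\beta\cdot\xi=\Psi_\gamma(\beta)\xi$ for $\beta\in\Lambda V^*$, $\xi\in\Sigma$. $\Sigma^\mu=\{\xi\in\Sigma:\gamma(\nu)\xi=\mu\xi\}$. With $\pi$ the parity automorphism and $\tau$ the reversion anti-automorphism of $\mathrm{Cl}(V^*,h^* )$, an admissible bilinear pairing is a non-degenerate, symmetric or skew-symmetric bilinear pairing $\mathscr{B}$ on $\Sigma$ such that for some $s\in\{\pm1\}$, $\mathscr{B}(\gamma(x)\xi_1,\xi_2)=\mathscr{B}(\xi_1,\gamma((\pi^{\frac{1-s}{2}}\circ\tau)(x))\xi_2)$ for all $x,\xi_1,\xi_2$. The signed square of $\xi$ is $\mathcal{E}^\kappa_\gamma(\xi)=\Psi_\gamma^{-1}(\kappa\,\xi\otimes\mathscr{B}(-,\xi))\in\Lambda V^*$ for some $\kappa\in\{\pm1\}$. A non-zero spinor $\xi$ is pure if $\{\theta\in V^*:\gamma(\theta)\xi=0\}$ has maximal possible dimension $p$; the signed square of a pure spinor is a decomposable $p$-form. *)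

(* Defs.v *)
From HB Require Import structures.
From mathcomp Require Import all_boot all_order all_algebra.
From mathcomp Require Import boolp functions reals.

Set Implicit Arguments.
Unset Strict Implicit.
Unset Printing Implicit Defensive.

Import Order.TTheory GRing.Theory Num.Theory.
Local Open Scope ring_scope.

Notation dual V := 'Hom(V, GRing.regular _).

(* An element of the exterior algebra of V^* is given by its alternating
   multilinear components of all degrees at once, as a function of the list of
   its arguments: the restriction to lists of length k is the component in
   Lambda^k V^*.  Components of degree greater than dim V are zero. *)
Section ExteriorAlgebra.
Context {R : realType} {V : vectType R}.
Implicit Types (a b : seq V -> R) (u v : V) (s t : seq V).

Definition multilinear_alternating a : Prop :=
  (forall s t (c : R) u v,
     a (s ++ (c *: u + v) :: t) = c * a (s ++ u :: t) + a (s ++ v :: t)) /\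
  (forall s t v, a (s ++ v :: v :: t) = 0).

Definition extalg_pred : {pred (seq V -> R^o)} :=
  fun a => `[< multilinear_alternating a >].

Record extalg := ExtAlg { eval : seq V -> R^o; _ : eval \in extalg_pred }.

HB.instance Definition _ := [isSub for eval].
HB.instance Definition _ := [Choice of extalg by <:].

Lemma extalg_predP (a : seq V -> R^o) :
  reflect (multilinear_alternating a) (a \in extalg_pred).
Proof. exact: asboolP. Qed.

Lemma extalg_subproof : subsemimod_closed extalg_pred.
Proof.
split; first split.
- by apply/extalg_predP; split=> [s t c u v|s t v] //=; rewrite [RHS]addr0 [RHS]mulr0.
- move=> a b /extalg_predP[aL aA] /extalg_predP[bL bA].
  apply/extalg_predP; split=> [s t c u v|s t v].
    by rewrite -[LHS]/(a _ + b _) aL bL addrACA -mulrDr.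
  by rewrite -[LHS]/(a _ + b _) aA bA addr0.
- move=> k a /extalg_predP[aL aA]; apply/extalg_predP; split=> [s t c u v|s t v].
    by rewrite -[LHS]/(k * a _) aL mulrDr mulrCA.
  by rewrite -[LHS]/(k * a _) aA mulr0.
Qed.

HB.instance Definition _ :=
  GRing.SubChoice_isSubLmodule.Build R (seq V -> R^o) extalg_pred extalg
    extalg_subproof.

Lemma evalP (x : extalg) : multilinear_alternating (eval x).
Proof. by case: x => a aP; exact/extalg_predP. Qed.

Definition homogeneous (k : nat) (x : extalg) : Prop :=
  forall s, size s <> k -> eval x s = 0.

Lemma one_subproof :
  (fun s : seq V => (s == [::])%:R : R^o) \in extalg_pred.
Proof.
apply/extalg_predP; split=> [s t c u v|s t v]; last by case: s.
by case: s => [|? ?] /=; rewrite mulr0 addr0.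
Qed.

Definition ext_one : extalg := ExtAlg one_subproof.

Lemma of_dual_subproof (th : dual V) :
  (fun s : seq V => (if s is [:: v] then th v else 0) : R^o) \in extalg_pred.
Proof.
apply/extalg_predP; split=> [s t c u v|s t v].
  case: s => [|x [|y s]] /=; last by rewrite mulr0 addr0.
    by case: t => [|? ?]; rewrite ?linearP// mulr0 addr0.
  by rewrite mulr0 addr0.
by case: s => [|? [|? ?]].
Qed.

Definition of_dual (th : dual V) : extalg := ExtAlg (of_dual_subproof th).

Lemma contract_closed v a :
  multilinear_alternating a -> multilinear_alternating (fun s => a (v :: s)).
Proof.
by move=> [aL aA]; split=> [s t c x y|s t x];
  [exact: (aL (v :: s)) | exact: (aA (v :: s))].
Qed.

Lemma contract_subproof v (x : extalg) :
  (fun s => eval x (v :: s)) \in extalg_pred.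
Proof. exact/extalg_predP/contract_closed/evalP. Qed.

Definition contract v (x : extalg) : extalg := ExtAlg (contract_subproof v x).

Lemma sign_closed a : multilinear_alternating a ->
  multilinear_alternating (fun s => (-1) ^+ size s * a s).
Proof.
move=> [aL aA]; split=> [s t c x y|s t x]; last by rewrite aA mulr0.
by rewrite aL !size_cat/= mulrDr mulrCA.
Qed.

Lemma grading_subproof (x : extalg) :
  (fun s => (-1) ^+ size s * eval x s : R^o) \in extalg_pred.
Proof. exact/extalg_predP/sign_closed/evalP. Qed.

Definition grading (x : extalg) : extalg := ExtAlg (grading_subproof x).

(* The wedge product with the determinant convention (sum over shuffles, no
   factorials), defined by recursion on the arguments through the antiderivation
   rule iota_v (a /\ b) = (iota_v a) /\ b + pi(a) /\ (iota_v b), where pi is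
   (-1)^k in degree k. *)
Fixpoint wedge_fun a b s : R :=
  if s is v :: t then
    wedge_fun (fun w => a (v :: w)) b t
    + wedge_fun (fun w => (-1) ^+ size w * a w) (fun w => b (v :: w)) t
  else a [::] * b [::].

Lemma eq_wedge_fun a a' b b' : a =1 a' -> b =1 b' ->
  wedge_fun a b =1 wedge_fun a' b'.
Proof.
move=> aa' bb' s; elim: s a a' b b' aa' bb' => [|v s IH] a a' b b' aa' bb' /=.
  by rewrite aa' bb'.
by congr (_ + _); apply: IH => // w /=; rewrite ?aa' ?bb'.
Qed.

Lemma wedge_funP (c : R) a a1 a2 b s :
  (forall w, a w = c * a1 w + a2 w) ->
  wedge_fun a b s = c * wedge_fun a1 b s + wedge_fun a2 b s.
Proof.
elim: s a a1 a2 b => [|v s IH] a a1 a2 b aE /=.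
  by rewrite aE mulrDl mulrA.
have -> := IH _ (fun w => a1 (v :: w)) (fun w => a2 (v :: w)) b
  (fun w => aE (v :: w)).
have -> := IH (fun w => (-1) ^+ size w * a w)
  (fun w => (-1) ^+ size w * a1 w) (fun w => (-1) ^+ size w * a2 w)
  (fun w => b (v :: w)).
  by rewrite mulrDr addrACA.
by move=> w; rewrite aE mulrDr mulrCA.
Qed.

Lemma wedge_funPr (c : R) a b b1 b2 s :
  (forall w, b w = c * b1 w + b2 w) ->
  wedge_fun a b s = c * wedge_fun a b1 s + wedge_fun a b2 s.
Proof.
elim: s a b b1 b2 => [|v s IH] a b b1 b2 bE /=.
  by rewrite bE mulrDr mulrCA.
have -> := IH (fun w => a (v :: w)) b b1 b2 bE.
have -> := IH (fun w => (-1) ^+ size w * a w) _ _ _ (fun w => bE (v :: w)).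
by rewrite mulrDr addrACA.
Qed.

Lemma wedge_fun0l a b s : a =1 (fun=> 0) -> wedge_fun a b s = 0.
Proof.
move=> a0; have := @wedge_funP (-1) a a a b s.
by rewrite mulN1r addNr; apply=> w; rewrite a0 mulr0 addr0.
Qed.

Lemma wedge_fun0r a b s : b =1 (fun=> 0) -> wedge_fun a b s = 0.
Proof.
move=> b0; have := @wedge_funPr (-1) a b b b s.
by rewrite mulN1r addNr; apply=> w; rewrite b0 mulr0 addr0.
Qed.

Lemma wedge_closed a b :
  multilinear_alternating a -> multilinear_alternating b ->
  multilinear_alternating (wedge_fun a b).
Proof.
move=> aP bP; split=> [s t c u v|s t v].
  elim: s a b aP bP => [|x s IH] a b aP bP /=; last first.
    rewrite IH//; last exact: contract_closed.
    rewrite (IH _ _ (sign_closed aP) (contract_closed x bP)).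
    by rewrite mulrDr addrACA.
  rewrite (@wedge_funP c _ _ _ _ _ (fun w => aP.1 [::] w c u v)).
  rewrite (@wedge_funPr c _ _ _ _ _ (fun w => bP.1 [::] w c u v)).
  by rewrite mulrDr addrACA.
elim: s a b aP bP => [|x s IH] a b aP bP /=; last first.
  by rewrite !IH ?addr0//; (exact: contract_closed || exact: sign_closed).
rewrite [X in X + _ + _]wedge_fun0l ?add0r; last by move=> w; apply: (aP.2 [::]).
rewrite [X in _ + (_ + X)]wedge_fun0r ?addr0; last by move=> w; apply: (bP.2 [::]).
rewrite (@wedge_funP (-1) (fun w => (-1) ^+ size (v :: w) * a (v :: w))
  (fun w => (-1) ^+ size w * a (v :: w)) (fun=> 0)).
  by rewrite (@wedge_fun0l (fun=> 0))// addr0 mulN1r addrN.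
by move=> w; rewrite addr0 /= exprS mulrA.
Qed.

Lemma wedge_subproof (x y : extalg) :
  (wedge_fun (eval x) (eval y) : seq V -> R^o) \in extalg_pred.
Proof. by apply/extalg_predP/wedge_closed; exact: evalP. Qed.

Definition wedge (x y : extalg) : extalg := ExtAlg (wedge_subproof x y).

Lemma contract_wedge v (x y : extalg) :
  contract v (wedge x y) =
    wedge (contract v x) y + wedge (grading x) (contract v y).
Proof. exact/val_inj/funext. Qed.

Definition wedge_family (k : nat) (th : 'I_k -> dual V) : extalg :=
  \big[wedge/ext_one]_(i < k) of_dual (th i).

End ExteriorAlgebra.
Arguments extalg {R} V.

Section QuadraticSpace.
Context {R : realType} {V : vectType R} (h : {symmetric V}).

Definition orthonormal_basis (n : nat) (e : n.-tuple V) : Prop :=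
  [/\ basis_of fullv e,
      forall i j : 'I_n, i != j -> h (tnth e i) (tnth e j) = 0 &
      forall i : 'I_n, h (tnth e i) (tnth e i) = 1 \/
                       h (tnth e i) (tnth e i) = -1].

Definition has_signature (p q : nat) : Prop :=
  exists e : (p + q).-tuple V, orthonormal_basis e /\
    forall i : 'I_(p + q), h (tnth e i) (tnth e i) = (-1) ^+ (p <= i)%N.

Definition flat (v : V) : dual V := linfun (h v : V -> R^o).

(* The inverse of the linear map flat when h is non-degenerate. *)
Definition sharp (th : dual V) : V := ((linfun flat)^-1)%VF th.

Definition hdual (th et : dual V) : R := h (sharp th) (sharp et).

Lemma flatE (u v : V) : flat u v = h u v.
Proof. by rewrite lfunE. Qed.

Lemma flat_linear : linear flat.
Proof.
move=> c u v; apply/lfunP => w; rewrite add_lfunE scale_lfunE !flatE.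
by rewrite linearPl.
Qed.
HB.instance Definition _ :=
  GRing.isLinear.Build R V (dual V) _ flat flat_linear.

Lemma sharpE (th : dual V) (v : V) :
  (forall u, (forall w, h u w = 0) -> u = 0) -> h (sharp th) v = th v.
Proof.
move=> hnd; have kF : lker (linfun flat) == 0%VS.
  apply/eqP/vspaceP => u; rewrite memv_ker memv0 lfunE /=.
  apply/eqP/eqP => [fu|->]; last by rewrite linear0.
  by apply: hnd => w; rewrite -flatE fu lfunE.
have imF : limg (linfun flat) = fullv.
  apply/eqP; rewrite eqEdim subvf /= limg_dim_eq; last by rewrite (eqP kF) capv0.
  by rewrite !dimvf /dim /= muln1.
have : th \in limg (linfun flat) by rewrite imF memvf.
by move=> /limg_lfunVK; rewrite -/(sharp th) lfunE /= => {2}<-; rewrite flatE.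
Qed.

(* beta triangle_1 delta, computed in the basis e with inverse Gram matrix
   h^{ij}. *)
Definition triangle1 (n : nat) (e : n.-tuple V) (b d : extalg V) : extalg V :=
  let hinv := invmx (\matrix_(i < n, j < n) h (tnth e i) (tnth e j)) in
  \sum_(i < n) \sum_(j < n)
    hinv i j *: wedge (contract (tnth e i) b) (contract (tnth e j) d).

(* The metric induced on the exterior algebra, with the determinant
   convention. *)
Definition induced_metric (g : {symmetric (extalg V)}) : Prop :=
  (forall k (th et : 'I_k -> dual V),
     g (wedge_family th) (wedge_family et) =
       \det (\matrix_(i < k, j < k) hdual (th i) (et j))) /\
  (forall k l (th : 'I_k -> dual V) (et : 'I_l -> dual V), k <> l ->
     g (wedge_family th) (wedge_family et) = 0).

(* An orientation is represented by a reference basis o, which is declared to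
   be positive. *)
Definition positively_oriented (n : nat) (o e : n.-tuple V) : Prop :=
  0 < \det (\matrix_(i < n, j < n) coord o j (tnth e i)).

Definition volume_form (n : nat) (o : n.-tuple V) (nu : extalg V) : Prop :=
  homogeneous n nu /\
  forall e : n.-tuple V, orthonormal_basis e -> positively_oriented o e ->
    eval nu e = 1.

(* The defining identity is imposed on forms of equal degree: in mixed degrees
   wedge b (star d) is not of top degree. *)
Definition hodge_star (g : {symmetric (extalg V)}) (nu : extalg V)
    (star : {linear extalg V -> extalg V}) : Prop :=
  forall (k : nat) (d : extalg V), (k <= \dim {:V})%N -> homogeneous k d ->
    homogeneous (\dim {:V} - k) (star d) /\
    forall b : extalg V, homogeneous k b -> wedge b (star d) = g b d *: nu.

(* The universal property: A is generated by V^* subject to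
   theta^2 = h^*(theta, theta). *)
Definition clifford_algebra (A : algType R) (cl : {linear dual V -> A}) : Prop :=
  (forall th, cl th * cl th = (hdual th th)%:A) /\
  forall (B : algType R) (f : {linear dual V -> B}),
    (forall th, f th * f th = (hdual th th)%:A) ->
    exists F : {lrmorphism A -> B}, (forall th, F (cl th) = f th) /\
      forall G : {lrmorphism A -> B}, (forall th, G (cl th) = f th) -> G =1 F.

Definition geometric_product
    (gp : {bilinear extalg V -> extalg V -> extalg V}) : Prop :=
  [/\ associative gp, left_id ext_one gp, right_id ext_one gp &
      forall (th : dual V) (b : extalg V),
        gp (of_dual th) b = wedge (of_dual th) b + contract (sharp th) b].

Definition chevalley_riesz
    (gp : {bilinear extalg V -> extalg V -> extalg V})
    (A : algType R) (cl : {linear dual V -> A})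
    (Psi : {linear extalg V -> A}) : Prop :=
  [/\ bijective Psi, Psi ext_one = 1,
      forall b d, Psi (gp b d) = Psi b * Psi d &
      forall th, Psi (of_dual th) = cl th].

End QuadraticSpace.

Section Spinors.
Context {R : realType} {V : vectType R} {A : algType R}.
Variables (cl : {linear dual V -> A}).

Definition parity_automorphism (par : {lrmorphism A -> A}) : Prop :=
  forall th, par (cl th) = - cl th.

Definition reversion (rev : {linear A -> A}) : Prop :=
  [/\ rev 1 = 1, forall x y, rev (x * y) = rev y * rev x &
      forall th, rev (cl th) = cl th].

Context {S : vectType R}.
Variable gam : {linear A -> 'End(S)}.

Definition left_module : Prop :=
  gam 1 = \1%VF /\ forall x y, gam (x * y) = (gam x \o gam y)%VF.

Definition irreducible_module : Prop :=
  [/\ left_module, (fullv : {vspace S}) <> 0%VS &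
      forall U : {vspace S}, (forall x, (gam x @: U <= U)%VS) ->
        U = 0%VS \/ U = fullv].

(* The boolean k stands for (1 - s)/2, with s = 1 or -1. *)
Definition admissible_pairing (par : {lrmorphism A -> A})
    (rev : {linear A -> A}) (B : {biscalar S}) : Prop :=
  [/\ forall x1, (forall x2, B x1 x2 = 0) -> x1 = 0,
      (forall x1 x2, B x1 x2 = B x2 x1) \/ (forall x1 x2, B x1 x2 = - B x2 x1) &
      exists k : bool, forall x x1 x2,
        B (gam x x1) x2 = B x1 (gam (iter k par (rev x)) x2)].

Definition pure_spinor (p : nat) (xi : S) : Prop :=
  xi <> 0 /\
  exists N : {vspace dual V}, \dim N = p /\
    forall th, th \in N <-> gam (cl th) xi = 0.

Variable Psi : {linear extalg V -> A}.

Definition clifford_action (b : extalg V) (xi : S) : S := gam (Psi b) xi.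

(* a = (gam o Psi)^-1 (kappa xi (x) B(-, xi)). *)
Definition signed_square (B : {biscalar S}) (kappa : R) (xi : S)
    (a : extalg V) : Prop :=
  forall zeta, gam (Psi a) zeta = kappa *: (B zeta xi *: xi).

Definition has_chirality (nu : extalg V) (mu : R) (xi : S) : Prop :=
  clifford_action nu xi = mu *: xi.

End Spinors.

(* Main.v *)
Require Import Defs.
From HB Require Import structures.
From mathcomp Require Import all_boot all_order all_algebra.
From mathcomp Require Import boolp functions reals ring zify.

Set Implicit Arguments.
Unset Strict Implicit.
Unset Printing Implicit Defensive.

Import Order.TTheory GRing.Theory Num.Theory.
Local Open Scope ring_scope.

(** Everything about a pure spinor xi can be read off its annihilator N in V^*,
or equivalently off the Lagrangian subspace L of V that is h-dual to N: a
covector kills xi iff it vanishes on L ([annihilator_eq]).  The proof translates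
the spinor equation and the equations between forms into the same conditions on
the restrictions of phi and H to L.

Spinors.  The graded commutator of a covector a with a form x in the Clifford
algebra is twice the contraction of x by the dual vector of a
([gp_supercommutator]); so, for v in L, acting by the covector dual to v turns
x.xi into 2 (i_v x).xi ([act_act]).  Acting with vectors of L on phi.xi = H.xi
therefore shows that H vanishes on L and that (i_v H).xi = phi(v) xi for v in L.
Conversely a 3-form vanishing on L lies in the ideal generated by N, hence acts
on xi as some covector ([act_vanishing]), which these conditions compare with
phi ([act_eqP]).

Forms.  The Clifford action is faithful on forms of definite parity
([act_faithful]); hence the signed square alpha is a nonzero p-form killed by the
exterior products with N and by the contractions with L.  A form of degree
greater than p is determined by its contractions with L, since it is already
zero when it lives on the p-dimensional quotient V / L ([eq_of_contractL]).  So
H /\ alpha = 0 iff H vanishes on L ([wedge_alpha3P]), and then phi /\ alpha =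
H triangle_1 alpha can be tested after contraction with v in L
([wedge_triangle1P]).  The link with spinors is that a 2-form w vanishing on L
acts on xi by a scalar t for which w triangle_1 alpha = - t alpha
([act_triangle1_vanishing]).  This settles p >= 3.

For p = 2 the space has dimension 4 and H = - i_v nu, where v is the dual vector
of star H ([star_hyperform]); since nu.xi = mu xi, this gives
H.xi = - mu (star H).xi.  The equation becomes that the covector phi + mu star H
kills xi, and a covector kills xi iff its exterior product with alpha vanishes ([dual_wedge_alphaP]). *)

(** * The exterior algebra: linearity, contractions and degrees *)

Section ExteriorAlgebraTheory.
Context {R : realType} {V : vectType R}.
Implicit Types (x y z : extalg V) (u v w : V) (s t : seq V) (a b : dual V).

Lemma extalg_eq x y : (forall s, eval x s = eval y s) -> x = y.
Proof. by move=> xy; apply/val_inj/funext. Qed.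

Lemma evalD x y s : eval (x + y) s = eval x s + eval y s.
Proof. by []. Qed.

Lemma evalN x s : eval (- x) s = - eval x s.
Proof. by []. Qed.

Lemma evalZ (c : R) x s : eval (c *: x) s = c * eval x s.
Proof. by []. Qed.

Lemma eval_sum (I : Type) (r : seq I) (P : pred I) (F : I -> extalg V) s :
  eval (\sum_(i <- r | P i) F i) s = \sum_(i <- r | P i) eval (F i) s.
Proof. by elim/big_rec2: _ => // i y x _ <-. Qed.

Lemma contract_is_bilinear : bilinear_for
  (GRing.Scale.Law.clone _ _ *:%R _) (GRing.Scale.Law.clone _ _ *:%R _)
  (@contract R V).
Proof.
split=> [x|v] c u w; apply: extalg_eq => s //.
exact: ((evalP x).1 [::]).
Qed.

HB.instance Definition _ := bilinear_isBilinear.Build R V (extalg V) (extalg V)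
  _ _ (@contract R V) contract_is_bilinear.

Lemma wedge_is_bilinear : bilinear_for
  (GRing.Scale.Law.clone _ _ *:%R _) (GRing.Scale.Law.clone _ _ *:%R _)
  (@wedge R V).
Proof.
split=> [y|x] c u w; apply: extalg_eq => s.
  exact: wedge_funP.
exact: wedge_funPr.
Qed.

HB.instance Definition _ := bilinear_isBilinear.Build R
  (extalg V) (extalg V) (extalg V) _ _ (@wedge R V) wedge_is_bilinear.

Lemma contractZl c v x : contract (c *: v) x = c *: contract v x.
Proof. exact: linearZl_LR. Qed.

Lemma contractZr c v x : contract v (c *: x) = c *: contract v x.
Proof. exact: linearZr_LR. Qed.

Lemma wedgeZl c x y : wedge (c *: x) y = c *: wedge x y.
Proof. exact: linearZl_LR. Qed.

Lemma wedgeZr c x y : wedge x (c *: y) = c *: wedge x y.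
Proof. exact: linearZr_LR. Qed.

Lemma contract0l x : contract 0 x = 0.
Proof. exact: linear0l. Qed.

Lemma contract0r v : contract v 0 = 0.
Proof. exact: linear0r. Qed.

Lemma contractNr v x : contract v (- x) = - contract v x.
Proof. exact: linearNr. Qed.

Lemma contractDr v x y : contract v (x + y) = contract v x + contract v y.
Proof. exact: linearDr. Qed.

Lemma contract_suml (I : Type) (r : seq I) (P : pred I) F x :
  contract (\sum_(i <- r | P i) F i) x = \sum_(i <- r | P i) contract (F i) x.
Proof. exact: linear_sumlz. Qed.

Lemma contract_sumr (I : Type) (r : seq I) (P : pred I) v F :
  contract v (\sum_(i <- r | P i) F i) = \sum_(i <- r | P i) contract v (F i).
Proof. exact: linear_sumr. Qed.

Lemma wedge0l x : wedge 0 x = 0.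
Proof. exact: linear0l. Qed.

Lemma wedge0r x : wedge x 0 = 0.
Proof. exact: linear0r. Qed.

Lemma wedgeNl x y : wedge (- x) y = - wedge x y.
Proof. exact: linearNl. Qed.

Lemma wedgeNr x y : wedge x (- y) = - wedge x y.
Proof. exact: linearNr. Qed.

Lemma wedgeDl x y z : wedge (x + y) z = wedge x z + wedge y z.
Proof. exact: linearDl. Qed.

Lemma wedgeDr x y z : wedge x (y + z) = wedge x y + wedge x z.
Proof. exact: linearDr. Qed.

Lemma wedge_sumr (I : Type) (r : seq I) (P : pred I) x F :
  wedge x (\sum_(i <- r | P i) F i) = \sum_(i <- r | P i) wedge x (F i).
Proof. exact: linear_sumr. Qed.

Lemma grading_is_linear : linear (@grading R V).
Proof.
by move=> c x y; apply: extalg_eq => s; rewrite /= mulrDr mulrCA.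
Qed.

HB.instance Definition _ := GRing.isLinear.Build R (extalg V) (extalg V) _
  (@grading R V) grading_is_linear.

Lemma of_dual_is_linear : linear (@of_dual R V).
Proof.
move=> c a b; apply: extalg_eq => -[|v [|? ?]] /=; rewrite /= ?evalD ?evalZ/=.
- by rewrite [RHS]addr0 [RHS]mulr0.
- by rewrite add_lfunE scale_lfunE.
- by rewrite [RHS]addr0 [RHS]mulr0.
Qed.

HB.instance Definition _ := GRing.isLinear.Build R (dual V) (extalg V) _
  (@of_dual R V) of_dual_is_linear.

Lemma eval_contract v x s : eval (contract v x) s = eval x (v :: s).
Proof. by []. Qed.

Lemma eval_swap x s t u v :
  eval x (s ++ u :: v :: t) = - eval x (s ++ v :: u :: t).
Proof.
have [L A] := evalP x; apply/eqP; rewrite -addr_eq0; apply/eqP.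
have := A s t (u + v); rewrite -{1}[u]scale1r L mul1r.
have L1 w w1 w2 : eval x (s ++ w :: (w1 + w2) :: t) =
    eval x (s ++ w :: w1 :: t) + eval x (s ++ w :: w2 :: t).
  have := L (s ++ [:: w]) t 1 w1 w2.
  by rewrite -!catA /= mul1r scale1r.
by rewrite !L1 !A add0r addr0.
Qed.

Lemma eval_to_front x s t v :
  eval x (s ++ v :: t) = (-1) ^+ size s * eval x (v :: s ++ t).
Proof.
elim: s x => [|u s IH] x; first by rewrite mul1r.
rewrite /= -eval_contract IH eval_contract (eval_swap x [::]) /=.
by rewrite exprS mulN1r mulrN mulNr.
Qed.

Lemma eval_dup x s : ~~ uniq s -> eval x s = 0.
Proof.
elim: s x => [//|v s IH] x /=; rewrite negb_and negbK => /orP[|us].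
  move=> /splitPr[s1 s2]; rewrite -eval_contract eval_to_front eval_contract.
  by rewrite ((evalP x).2 [::]) mulr0.
by rewrite -eval_contract IH.
Qed.

Lemma eval_spanning0 (f : seq V) x k : <<f>>%VS = fullv ->
  (forall s, {subset s <= f} -> size s = k -> eval x s = 0) ->
  forall s, size s = k -> eval x s = 0.
Proof.
move=> ff; elim: k x => [|k IH] x x0 [|v s]//; first by move=> _; exact: x0.
move=> [sk]; have /coord_span -> : v \in <<in_tuple f>>%VS by rewrite ff memvf.
rewrite -eval_contract contract_suml eval_sum big1 // => i _.
rewrite contractZl evalZ.
rewrite (IH (contract _ x)) ?mulr0// => t tf tk.
rewrite eval_contract; apply: x0 => /=; last by rewrite tk.
by move=> w; rewrite inE => /orP[/eqP ->|/tf//]; rewrite mem_nth.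
Qed.

(** A form killed by the contractions with U lives on the quotient by U, whose
dimension bounds its degree.  In a basis adapted to U, an argument list of
larger size either contains a vector of U or repeats a vector. *)
Lemma eval_transversal0 (U : {vspace V}) x s :
  (forall u, u \in U -> contract u x = 0) ->
  (\dim {:V} - \dim U < size s)%N -> eval x s = 0.
Proof.
move=> xU; set k := size s => kd.
apply: (@eval_spanning0 (vbasis U ++ vbasis (U^C)) x k) => //.
  by rewrite span_cat !(span_basis (vbasisP _)) addv_complf.
move=> t tf tk; have [/hasP[v vt vU]|/hasPn tU] := boolP (has (mem U) t).
  move/splitPr: vt => [t1 t2].
  by rewrite eval_to_front -eval_contract xU ?mulr0.
apply: eval_dup; apply/negP => /uniq_leq_size H.
have: (size t <= size (vbasis (U^C)))%N.
  apply: H => v vt; move: (tf v vt); rewrite mem_cat => /orP[/vbasis_mem vU|//].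
  by have := tU v vt; rewrite /= vU.
rewrite size_tuple dimv_compl tk => H'; by have := leq_trans kd H'; rewrite ltnn.
Qed.

Lemma eval_oversize x s : (\dim {:V} < size s)%N -> eval x s = 0.
Proof.
move=> ds; apply: (@eval_transversal0 0%VS); last by rewrite dimv0 subn0.
by move=> u; rewrite memv0 => /eqP ->; rewrite contract0l.
Qed.

Lemma contract_one v : contract v ext_one = 0.
Proof. exact: extalg_eq. Qed.

Lemma grading_one : grading ext_one = ext_one :> extalg V.
Proof. by apply: extalg_eq => -[|? ?]; rewrite /= ?mulr0 ?mul1r. Qed.

Lemma wedge1x x : wedge ext_one x = x.
Proof.
apply: extalg_eq => s; elim: s x => [|v s IH] x; first by rewrite /= mul1r.
rewrite -eval_contract contract_wedge contract_one wedge0l add0r grading_one.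
exact: IH.
Qed.

Lemma contract_grading v x : contract v (grading x) = - grading (contract v x).
Proof. by apply: extalg_eq => t; rewrite evalN /= exprS mulN1r mulNr. Qed.

Lemma contract_of_dual v a : contract v (of_dual a) = a v *: ext_one.
Proof.
apply: extalg_eq => -[|? ?]; rewrite eval_contract evalZ/= ?mulr1//.
by rewrite mulr0.
Qed.

Lemma grading_of_dual a : grading (of_dual a) = - of_dual a.
Proof.
apply: extalg_eq => -[|v [|? ?]]; rewrite evalN /=.
- by rewrite mulr0 oppr0.
- by rewrite expr1 mulN1r.
- by rewrite mulr0 oppr0.
Qed.

Lemma contract_dual_wedge v a x :
  contract v (wedge (of_dual a) x) =
  a v *: x - wedge (of_dual a) (contract v x).
Proof.
rewrite contract_wedge contract_of_dual grading_of_dual wedgeNl.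
by rewrite wedgeZl wedge1x.
Qed.

Lemma contract_anticomm u v x :
  contract u (contract v x) = - contract v (contract u x).
Proof.
by apply: extalg_eq => s; rewrite evalN !eval_contract (eval_swap x [::]).
Qed.

Lemma eval_dual_wedge_nil a x : eval (wedge (of_dual a) x) [::] = 0.
Proof. exact: mul0r. Qed.

Lemma dual_wedge_anticomm a b x :
  wedge (of_dual a) (wedge (of_dual b) x) =
  - wedge (of_dual b) (wedge (of_dual a) x).
Proof.
apply: extalg_eq => s; elim: s x => [|v s IH] x.
  by rewrite evalN !eval_dual_wedge_nil oppr0.
rewrite evalN -!eval_contract !contract_dual_wedge !wedgeDr !wedgeNr !wedgeZr.
by rewrite !evalD !evalN !evalD !evalN !evalZ IH evalN; ring.
Qed.

Lemma gradingN x : grading (- x) = - grading x.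
Proof. exact: linearN. Qed.

Lemma gradingD x y : grading (x + y) = grading x + grading y.
Proof. exact: linearD. Qed.

Lemma gradingZ c x : grading (c *: x) = c *: grading x.
Proof. exact: linearZ. Qed.

Lemma grading_dual_wedge a x :
  grading (wedge (of_dual a) x) = - wedge (of_dual a) (grading x).
Proof.
apply: extalg_eq => s; elim: s x => [|v s IH] x.
  by rewrite evalN /= !mul0r mulr0 oppr0.
rewrite evalN -!eval_contract contract_grading !contract_dual_wedge.
rewrite gradingD gradingN gradingZ contract_grading wedgeNr opprK.
by rewrite evalN !evalD !evalN IH evalN; ring.
Qed.

Lemma wedgex1 x : wedge x ext_one = x.
Proof.
apply: extalg_eq => s; elim: s x => [|v s IH] x; first by rewrite /= mulr1.
by rewrite -eval_contract contract_wedge contract_one wedge0r addr0 IH.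
Qed.

Lemma wedge_of_dualC x a : wedge x (of_dual a) = wedge (of_dual a) (grading x).
Proof.
apply: extalg_eq => s; elim: s x => [|v s IH] x.
  by rewrite eval_dual_wedge_nil /= mulr0.
rewrite -!eval_contract contract_wedge contract_dual_wedge contract_of_dual.
rewrite wedgeZr wedgex1 !evalD evalN IH contract_grading wedgeNr evalN opprK.
exact: addrC.
Qed.

Lemma homogeneous_contract k v x :
  homogeneous k.+1 x -> homogeneous k (contract v x).
Proof. by move=> xk s sk; rewrite eval_contract xk //=; move=> [/sk]. Qed.

Lemma homogeneous_of_dual a : homogeneous 1 (of_dual a).
Proof. by move=> [|v [|? ?]]. Qed.

Lemma homogeneousD k x y :
  homogeneous k x -> homogeneous k y -> homogeneous k (x + y).
Proof. by move=> xk yk s sk; rewrite evalD xk// yk// addr0. Qed.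

Lemma homogeneousZ k c x : homogeneous k x -> homogeneous k (c *: x).
Proof. by move=> xk s sk; rewrite evalZ xk// mulr0. Qed.

Lemma homogeneous_wedge k l x y :
  homogeneous k x -> homogeneous l y -> homogeneous (k + l) (wedge x y).
Proof.
move=> xk yl s; elim: s k l x y xk yl => [|v s IH] k l x y xk yl /= skl.
  case: k => [|k] in xk skl *; last by rewrite xk ?mul0r.
  by rewrite yl ?mulr0//; move: skl; rewrite add0n.
rewrite -[LHS]/(eval (wedge (contract v x) y) s +
  eval (wedge (grading x) (contract v y)) s).
have gk : homogeneous k (grading x) by move=> t tk; rewrite /= xk ?mulr0.
have c0 z : homogeneous 0 z -> contract v z = 0.
  by move=> z0; apply: extalg_eq => t; rewrite eval_contract z0.
have -> : eval (wedge (contract v x) y) s = 0.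
  case: k => [|k] in xk gk skl *; first by rewrite c0 // wedge0l.
  apply: (IH k l) => //; first exact: homogeneous_contract.
  by move=> sE; apply: skl; rewrite sE.
rewrite add0r; case: l => [|l] in yl skl *; first by rewrite (c0 y)// wedge0r.
apply: (IH k l) => //; first exact: homogeneous_contract.
by move=> sE; apply: skl; rewrite sE addnS.
Qed.

Lemma homogeneous0E x : homogeneous 0 x -> x = eval x [::] *: ext_one.
Proof.
by move=> x0; apply: extalg_eq => -[|v s]; rewrite evalZ /= ?mulr1// mulr0 x0.
Qed.

Lemma homogeneous1E x : homogeneous 1 x -> exists a, x = of_dual a.
Proof.
move=> x1; pose f v := eval x [:: v] : R^o.
have fl : linear f by move=> c u v; exact: ((evalP x).1 [::]).
pose fL := HB.pack f (GRing.isLinear.Build _ _ _ _ f fl) : {linear V -> R^o}.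
exists (linfun fL); apply: extalg_eq => -[|v [|? ?]]; [exact: x1| |exact: x1].
by rewrite [RHS]lfunE.
Qed.

(** Euler's formula: the sum of the f^i /\ i_(f_i) over a resolution of the
identity is the degree operator.  It rebuilds a form from its contractions, which
makes inductions on the degree possible. *)
Lemma wedge_contract_sum (I : finType) (r : I -> dual V) (f : I -> V) x s :
  (forall v, \sum_i r i v *: f i = v) ->
  eval (\sum_i wedge (of_dual (r i)) (contract (f i) x)) s =
    (size s)%:R * eval x s.
Proof.
move=> rf; elim: s x => [|v s IH] x.
  by rewrite mul0r eval_sum big1 // => i _; exact: eval_dual_wedge_nil.
rewrite -eval_contract contract_sumr.
under eq_bigr do rewrite contract_dual_wedge contract_anticomm wedgeNr opprK.
rewrite big_split evalD IH /= -add1n natrD mulrDl mul1r.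
congr (_ + _); rewrite -{2}(rf v) -eval_contract contract_suml /=.
by congr (eval _ s); apply: eq_bigr => i _; rewrite contractZl.
Qed.

Lemma homogeneous_wedge_contract_sum (I : finType) (r : I -> dual V)
    (f : I -> V) x k :
  (forall v, \sum_i r i v *: f i = v) -> homogeneous k x ->
  \sum_i wedge (of_dual (r i)) (contract (f i) x) = k%:R *: x.
Proof.
move=> rf xk; apply: extalg_eq => s; rewrite wedge_contract_sum// evalZ.
by have [->//|/eqP sk] := eqVneq (size s) k; rewrite xk // !mulr0.
Qed.

Lemma basis_resolution : exists (r : 'I_(\dim {:V}) -> dual V)
  (f : 'I_(\dim {:V}) -> V), forall v, \sum_i r i v *: f i = v.
Proof.
exists (fun i => linfun (coord (vbasis fullv) i : V -> R^o)).
exists (fun i => (vbasis fullv)`_i) => v.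
rewrite {2}(coord_vbasis (memvf v)).
by apply: eq_bigr => i _; rewrite lfunE.
Qed.

(** A resolution of the identity of V adapted to L: the members indexed by the
second family have a covector vanishing on L, the others have a vector in L. *)
Lemma adapted_resolution (L : {vspace V}) :
  exists (l : 'I_(\dim L) -> V) (lam : 'I_(\dim L) -> dual V)
    (c : 'I_(\dim {:V} - \dim L) -> V)
    (rho : 'I_(\dim {:V} - \dim L) -> dual V),
  [/\ forall i, l i \in L,
      forall j v, v \in L -> rho j v = 0 &
      forall v, \sum_i lam i v *: l i + \sum_j rho j v *: c j = v].
Proof.
pose Q := (\1 - projv L)%VF.
exists (fun i => tnth (vbasis L) i).
exists (fun i => linfun (coord (vbasis L) i \o projv L : V -> R^o)).
rewrite -dimv_compl.
exists (fun i => tnth (vbasis (L^C)) i).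
exists (fun i => linfun (coord (vbasis (L^C)) i \o Q : V -> R^o)).
split=> [i|j v vL|v].
- by rewrite vbasis_mem// mem_tnth.
- by rewrite lfunE /= add_lfunE opp_lfunE id_lfunE projv_id // subrr linear0.
under eq_bigr do rewrite lfunE /= (tnth_nth 0).
rewrite -coord_vbasis ?memv_proj//.
under eq_bigr do rewrite lfunE /= (tnth_nth 0).
by rewrite -coord_vbasis add_lfunE opp_lfunE id_lfunE ?memv_projC// addrC subrK.
Qed.

(** A form vanishing on L lies in the ideal generated by the annihilator of L,
here phrased as an induction principle.  Euler's formula in an adapted
resolution gives terms f^i /\ i_(f_i) x of two kinds: either f^i annihilates L,
or f_i is in L and i_(f_i) x vanishes on L, so that induction on the degree
applies to it. *)
Lemma annihilator_ind (L : {vspace V}) (P : extalg V -> Prop) k :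
  (forall c x y, P x -> P y -> P (c *: x + y)) ->
  (forall a y, (forall v, v \in L -> a v = 0) -> homogeneous k y ->
     P (wedge (of_dual a) y)) ->
  forall x, homogeneous k.+1 x ->
    (forall s, all (mem L) s -> eval x s = 0) -> P x.
Proof.
have [l [lam [c [rho [lL rhoL res]]]]] := adapted_resolution L.
pose r i := match i with inl i => lam i | inr j => rho j end.
pose f i := match i with inl i => l i | inr j => c j end.
have rf v : \sum_i r i v *: f i = v by rewrite big_sumType /= res.
have zeroP m (Q : extalg V -> Prop) : (forall a y,
    (forall v, v \in L -> a v = 0) -> homogeneous m y ->
    Q (wedge (of_dual a) y)) -> Q 0.
  move=> Pw; rewrite -(wedge0r (of_dual 0)).
  by apply: Pw => // v _; rewrite lfunE.
have step m (Q : extalg V -> Prop) y :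
    (forall c y z, Q y -> Q z -> Q (c *: y + z)) ->
    (forall a y, (forall v, v \in L -> a v = 0) -> homogeneous m y ->
       Q (wedge (of_dual a) y)) ->
    homogeneous m.+1 y ->
    (forall i, Q (wedge (of_dual (lam i)) (contract (l i) y))) -> Q y.
  move=> Pl Pw xk Plam; have P0 := zeroP m Q Pw.
  rewrite -[y]scale1r -(mulVf (_ : m.+1%:R != 0)) ?pnatr_eq0//.
  rewrite -scalerA -(homogeneous_wedge_contract_sum rf xk) -[_ *: _]addr0.
  apply: (Pl) => //; elim/big_ind: _ => // [z z' Pz Pz'|[i|j] _].
  - by rewrite -[z]scale1r; exact: Pl.
  - exact: Plam.
  - apply: (Pw); last exact: homogeneous_contract.
    by move=> v vL; exact: rhoL.
elim: k P => [|k IH] P Pl Pw x xk xL; apply: (step _ P x Pl Pw xk) => i.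
  have -> : contract (l i) x = 0.
    apply: extalg_eq => -[|v s]; rewrite eval_contract; last by rewrite xk.
    by rewrite xL //= lL.
  by rewrite wedge0r; exact: (zeroP 0 P Pw).
pose P' y := P (wedge (of_dual (lam i)) y).
apply: (IH P').
- by move=> c' y z Qy Qz; rewrite /P' wedgeDr wedgeZr; exact: Pl.
- move=> a y aL yk; rewrite /P' dual_wedge_anticomm -wedgeNr; apply: Pw => //.
  rewrite -scaleN1r; apply: homogeneousZ.
  exact: (homogeneous_wedge (@homogeneous_of_dual _) yk).
- exact: homogeneous_contract.
- by move=> s sL; rewrite eval_contract xL//= lL.
Qed.

End ExteriorAlgebraTheory.

(** * Musical isomorphisms of a non-degenerate form *)

Section QuadraticSpaceTheory.
Context {R : realType} {V : vectType R} (h : {symmetric V}).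
Implicit Types (u v w : V) (a b : dual V).

Lemma symmetricC u v : h u v = h v u.
Proof. by rewrite hermC expr0 mul1r. Qed.

Hypothesis hnd : forall u, (forall w, h u w = 0) -> u = 0.

Lemma nondegenerate_inj u v : (forall w, h u w = h v w) -> u = v.
Proof.
move=> uv; apply/eqP; rewrite -subr_eq0; apply/eqP/hnd => w.
by rewrite linearBl /= uv subrr.
Qed.

Lemma flatK v : sharp h (flat h v) = v.
Proof. by apply: nondegenerate_inj => w; rewrite sharpE // flatE. Qed.

Lemma sharpK a : flat h (sharp h a) = a.
Proof. by apply/lfunP => v; rewrite flatE sharpE. Qed.

Lemma sharp_swap a b : a (sharp h b) = b (sharp h a).
Proof. by rewrite -[in LHS](sharpK a) flatE symmetricC sharpE. Qed.

(** Lets [triangle1], which is defined in an arbitrary basis, be computed without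
any basis. *)
Lemma sharp_gram n (e : n.-tuple V) a : basis_of fullv e ->
  \sum_i \sum_j
    (invmx (\matrix_(i < n, j < n) h (tnth e i) (tnth e j)) i j * a (tnth e i))
      *: tnth e j = sharp h a.
Proof.
move=> eb; set G := \matrix_(i, j) _.
have eE v : v = \sum_i coord e i v *: tnth e i.
  rewrite {1}(coord_basis eb (memvf v)).
  by apply: eq_bigr => i _; rewrite (tnth_nth 0).
have Gu : G \in unitmx.
  rewrite -row_free_unit; apply: inj_row_free => c cG.
  have c0 : \sum_i c 0 i *: tnth e i = 0.
    apply: hnd => w; rewrite (eE w) linear_sumr big1 // => j _.
    rewrite linearZr_LR linear_sumlz /=.
    have := congr1 (fun M : 'rV_n => M 0 j) cG; rewrite !mxE => cGj.
    rewrite (_ : \sum_i _ = 0) ?mulr0// -[RHS]cGj.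
    by apply: eq_bigr => i _; rewrite mxE linearZl_LR.
  apply/rowP => i; rewrite mxE.
  have /freeP := basis_free eb; apply.
  by rewrite -[RHS]c0; apply: eq_bigr => j _; rewrite (tnth_nth 0).
apply: nondegenerate_inj => w; rewrite sharpE// {1}(eE w) {2}(eE w).
rewrite linear_sumr linear_sum /=; apply: eq_bigr => k _.
rewrite linearZr_LR linearZ /=; congr (_ * _).
rewrite linear_sumlz /=.
transitivity (\sum_i a (tnth e i) * (invmx G *m G) i k).
  apply: eq_bigr => i _; rewrite linear_sumlz mxE mulr_sumr /=.
  by apply: eq_bigr => j _; rewrite linearZl_LR /= mxE; ring.
rewrite mulVmx// (bigD1 k)//= mxE eqxx mulr1 big1 ?addr0// => i ik.
by rewrite mxE (negPf ik) mulr0.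
Qed.

End QuadraticSpaceTheory.

(** * The geometric product *)

Section GeometricProduct.
Context {R : realType} {V : vectType R} (h : {symmetric V}).
Hypothesis hnd : forall u, (forall w, h u w = 0) -> u = 0.
Variable gp : {bilinear extalg V -> extalg V -> extalg V}.
Hypothesis hgp : geometric_product h gp.
Implicit Types (x y z : extalg V) (u v w : V) (a b : dual V).

Let gpA : associative gp. Proof. by case: hgp. Qed.
Let gp1x : left_id ext_one gp. Proof. by case: hgp. Qed.
Let gpx1 : right_id ext_one gp. Proof. by case: hgp. Qed.
Let gp_dual a x : gp (of_dual a) x = wedge (of_dual a) x + contract (sharp h a) x.
Proof. by case: hgp. Qed.

(** Left Clifford multiplications by covectors generate the exterior algebra from
1: by Euler's formula a form is a sum of a /\ z with z of smaller degree, and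
a /\ z differs from the Clifford product of a and z by a contraction of z. *)
Lemma extalg_clifford_ind (P : extalg V -> Prop) :
  (forall c x y, P x -> P y -> P (c *: x + y)) -> P ext_one ->
  (forall a x, P x -> P (gp (of_dual a) x)) -> forall x, P x.
Proof.
move=> Pl P1 Pgp x.
have P0 : P 0 by have := Pl (-1) _ _ P1 P1; rewrite scaleN1r addNr.
have PZ c y : P y -> P (c *: y) by move=> Py; rewrite -[_ *: _]addr0; exact: (Pl).
have PD y z : P y -> P z -> P (y + z).
  by move=> Py Pz; rewrite -[y]scale1r; exact: (Pl).
have [r [f rf]] := @basis_resolution R V.
(* Forms are filtered by the degree from which on they vanish. *)
suff PF k : forall y, (forall s, (k <= size s)%N -> eval y s = 0) -> P y.
  apply: (PF (\dim {:V}).+1) => s; exact: eval_oversize.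
elim: k => [|k IH] y yk.
  by have -> : y = 0 by apply: extalg_eq => s; rewrite yk.
have [k0|k0] := eqVneq k 0%N.
  have -> : y = eval y [::] *: ext_one.
    apply: extalg_eq => -[|v s]; rewrite evalZ /= ?mulr1// mulr0 yk//.
    by rewrite k0.
  exact: PZ.
(* E has the same component as k y in degree k, which is the top degree of y. *)
pose E := \sum_i wedge (of_dual (r i)) (contract (f i) y).
have Ey s : eval E s = (size s)%:R * eval y s by exact: wedge_contract_sum.
have -> : y = k%:R^-1 *: (E + (k%:R *: y - E)).
  by rewrite addrC subrK scalerA mulVf ?scale1r// pnatr_eq0.
apply/PZ/PD; last first.
  apply: IH => s; rewrite leq_eqVlt => /orP[/eqP ks|ks].
    by rewrite evalD evalN evalZ Ey -ks subrr.
  by rewrite evalD evalN evalZ Ey yk// !mulr0 subrr.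
rewrite /E; elim/big_ind: _ => // i _.
have -> : wedge (of_dual (r i)) (contract (f i) y) =
  gp (of_dual (r i)) (contract (f i) y) +
  (- 1) *: contract (sharp h (r i)) (contract (f i) y).
  by rewrite gp_dual scaleN1r addrK.
apply: PD; last apply: PZ.
  by apply/Pgp/IH => s ks; rewrite eval_contract yk.
by apply: IH => s ks; rewrite !eval_contract yk //= ltnS leqW.
Qed.

Lemma gp_dual_anticomm a b x :
  gp (of_dual a) (gp (of_dual b) x) + gp (of_dual b) (gp (of_dual a) x) =
  (2%:R * a (sharp h b)) *: x.
Proof.
rewrite !gp_dual !wedgeDr !contractDr !contract_dual_wedge.
rewrite (dual_wedge_anticomm b a) (contract_anticomm (sharp h b)).
rewrite (sharp_swap hnd b a); apply: extalg_eq => s.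
by rewrite !evalD !evalN !evalZ; ring.
Qed.

Lemma contract_gp_dual v b x : contract v (gp (of_dual b) x) =
  b v *: x - gp (of_dual b) (contract v x).
Proof.
rewrite !gp_dual contractDr contract_dual_wedge contract_anticomm.
by rewrite opprD addrA.
Qed.

Lemma grading_gp_dual a x :
  grading (gp (of_dual a) x) = - gp (of_dual a) (grading x).
Proof.
by rewrite !gp_dual gradingD grading_dual_wedge contract_grading opprD opprK.
Qed.

(** Left multiplication by a covector is the sum of an exterior product and a
contraction, right multiplication is their difference up to the grading.  Both
sides satisfy the same Leibniz rule with respect to left multiplication by
covectors, whence the induction. *)
Lemma gp_supercommutator a x :
  gp (of_dual a) x - gp (grading x) (of_dual a) = 2%:R *: contract (sharp h a) x.
Proof.
elim/extalg_clifford_ind: x => [c x y IHx IHy||b x IHx].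
- rewrite linearPr /= gradingD gradingZ linearPl /= contractDr contractZr.
  by rewrite scalerDr scalerA [_ * c]mulrC -scalerA -IHx -IHy scalerBr opprD addrACA.
- by rewrite grading_one gp1x gpx1 subrr contract_one scaler0.
rewrite grading_gp_dual linearNl /= opprK -gpA.
have -> : gp (grading x) (of_dual a) =
  gp (of_dual a) x - 2%:R *: contract (sharp h a) x.
  by rewrite -IHx opprB addrC subrK.
rewrite linearBr /= addrA gp_dual_anticomm contract_gp_dual.
by rewrite linearZr_LR /= scalerBr scalerA (sharp_swap hnd).
Qed.

End GeometricProduct.

(** * The action of forms on spinors *)

Section SpinorAction.
Context {R : realType} {V : vectType R} (h : {symmetric V}).
Hypothesis hnd : forall u, (forall w, h u w = 0) -> u = 0.
Variable gp : {bilinear extalg V -> extalg V -> extalg V}.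
Hypothesis hgp : geometric_product h gp.
Context {Cl : algType R} (cl : {linear dual V -> Cl}).
Variable Psi : {linear extalg V -> Cl}.
Hypothesis hPsi : chevalley_riesz gp cl Psi.
Context {S : vectType R}.
Variable gam : {linear Cl -> 'End(S)}.
Hypothesis hgam : left_module gam.
Implicit Types (x y z : extalg V) (u v w : V) (a b : dual V) (zeta : S).

Local Notation act := (clifford_action gam Psi).

Lemma actD x y zeta : act (x + y) zeta = act x zeta + act y zeta.
Proof. by rewrite /clifford_action !linearD add_lfunE. Qed.

Lemma actZ c x zeta : act (c *: x) zeta = c *: act x zeta.
Proof. by rewrite /clifford_action !linearZ scale_lfunE. Qed.

Lemma actN x zeta : act (- x) zeta = - act x zeta.
Proof. by rewrite -scaleN1r actZ scaleN1r. Qed.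

Lemma act_one zeta : act ext_one zeta = zeta.
Proof.
have [_ Psi1 _ _] := hPsi; have [gam1 _] := hgam.
by rewrite /clifford_action Psi1 gam1 id_lfunE.
Qed.

Lemma act_gp x y zeta : act (gp x y) zeta = act x (act y zeta).
Proof.
have [_ _ PsiM _] := hPsi; have [_ gamM] := hgam.
by rewrite /clifford_action PsiM gamM comp_lfunE.
Qed.

Lemma act_of_dual a zeta : act (of_dual a) zeta = gam (cl a) zeta.
Proof. by have [_ _ _ PsiV] := hPsi; rewrite /clifford_action PsiV. Qed.

Lemma actZr x c zeta : act x (c *: zeta) = c *: act x zeta.
Proof. exact: linearZ. Qed.

Lemma act0r x : act x 0 = 0.
Proof. exact: linear0. Qed.

Lemma twice_inj (zeta zeta' : S) : 2%:R *: zeta = 2%:R *: zeta' -> zeta = zeta'.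
Proof. by apply: scalerI; rewrite pnatr_eq0. Qed.

(** The kernel of the action is a two-sided ideal.  For a form of definite parity
the graded commutator with a covector stays in that ideal, so every contraction
of the form acts trivially too; contracting down a component of highest degree
leaves a nonzero scalar, which cannot act trivially. *)
Lemma act_faithful x (c : R) zeta0 : zeta0 <> 0 -> grading x = c *: x ->
  (forall zeta, act x zeta = 0) -> x = 0.
Proof.
move=> z0 xc x0.
have contr v y d : grading y = d *: y -> (forall zeta, act y zeta = 0) ->
    grading (contract v y) = - d *: contract v y /\
    forall zeta, act (contract v y) zeta = 0.
  move=> yd y0; split=> [|zeta].
    by rewrite -[LHS]opprK -contract_grading yd contractZr scaleNr.
  apply: twice_inj; rewrite scaler0 -actZ -{1}(flatK hnd v).
  rewrite -(gp_supercommutator hnd hgp) yd actD actN linearZl_LR actZ !act_gp.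
  by rewrite !y0 act0r scaler0 subrr.
have contrs s : forall y d, grading y = d *: y -> (forall zeta, act y zeta = 0) ->
    exists y', (forall t, eval y' t = eval y (s ++ t)) /\ forall zeta, act y' zeta = 0.
  elim: s => [|v s IH] y d yd y0; first by exists y.
  have [cd c0] := contr v y d yd y0.
  by have [y' [y'E y'0]] := IH _ _ cd c0; exists y'.
have vanish m s : (\dim {:V} < size s + m)%N -> eval x s = 0.
  elim: m s => [|m IH] s sm; first by rewrite eval_oversize // -[size s]addn0.
  have [y [yE y0]] := contrs s x c xc x0.
  have yS : y = eval x s *: ext_one.
    apply: extalg_eq => -[|v t]; rewrite yE evalZ ?cats0 /= ?mulr1// mulr0 IH//.
    by rewrite (leq_trans sm)// size_cat /= -addnA leq_add2l addSn ltnS leq_addl.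
  have := y0 zeta0; rewrite yS actZ act_one => /eqP.
  by rewrite scaler_eq0 => /orP[/eqP//|/eqP/z0].
by apply: extalg_eq => s; rewrite (vanish (\dim {:V}).+1)// addnS ltnS leq_addl.
Qed.

(** * The annihilator of a pure spinor *)

Section PureSpinor.
Variables (xi : S) (L : {vspace V}).
Hypothesis xi_neq0 : xi <> 0.
Hypothesis memL : forall v, v \in L <-> act (of_dual (flat h v)) xi = 0.
Hypothesis annL : forall a, (forall v, v \in L -> a v = 0) <-> act (of_dual a) xi = 0.

Lemma sharp_annihilator a : (forall v, v \in L -> a v = 0) -> sharp h a \in L.
Proof. by move/annL => aL; apply/memL; rewrite sharpK. Qed.

(** The contraction comes from the graded commutator, because the covector dual
to v kills xi when it stands on the right. *)
Lemma act_act v x : v \in L ->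
  act (of_dual (flat h v)) (act x xi) = 2%:R *: act (contract v x) xi.
Proof.
move=> /memL v0; rewrite -actZ -{2}(flatK hnd v) -(gp_supercommutator hnd hgp).
by rewrite actD actN !act_gp v0 act0r subr0.
Qed.

(** Moving a to the right until it kills xi gives twice the contraction by the
dual vector of a; the difference between the exterior and the Clifford product
takes one of the two back. *)
Lemma act_dual_wedge a x : (forall v, v \in L -> a v = 0) ->
  act (wedge (of_dual a) x) xi = act (contract (sharp h a) x) xi.
Proof.
move=> aL; have [_ _ _ gpE] := hgp.
have -> : wedge (of_dual a) x = gp (of_dual a) x - contract (sharp h a) x.
  by rewrite gpE addrK.
rewrite actD actN act_gp -{1}(sharpK hnd a) act_act; last exact: sharp_annihilator.
by rewrite -[2%:R]/(1 + 1) scalerDl scale1r addrK.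
Qed.

(** By [act_dual_wedge], on the ideal generated by the annihilator of L the
action on xi lowers the degree by two. *)
Lemma act_vanishing k x : homogeneous k.+2 x ->
  (forall s, all (mem L) s -> eval x s = 0) ->
  exists2 y, homogeneous k y & act x xi = act y xi.
Proof.
apply: (annihilator_ind (P := fun x =>
  exists2 y, homogeneous k y & act x xi = act y xi)).
  move=> c {}x y [x' x'k xE] [y' y'k yE]; exists (c *: x' + y').
    exact/homogeneousD/y'k/homogeneousZ.
  by rewrite !actD !actZ xE yE.
move=> a y aL yk; exists (contract (sharp h a) y).
  exact: homogeneous_contract.
exact: act_dual_wedge.
Qed.

(** * The signed square of a pure spinor *)

Section SignedSquare.
Variable (alpha : extalg V).
Hypothesis alpha_neq0 : alpha <> 0.
Hypothesis wedge_alpha : forall a, (forall v, v \in L -> a v = 0) ->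
  wedge (of_dual a) alpha = 0.
Hypothesis contract_alpha : forall v, v \in L -> contract v alpha = 0.

(** Contracting a /\ alpha with v in L leaves a(v) alpha, so a /\ alpha = 0
forces a to vanish on L. *)
Lemma dual_wedge_alphaP a :
  wedge (of_dual a) alpha = 0 <-> act (of_dual a) xi = 0.
Proof.
split=> [aa|/annL]; last exact: wedge_alpha.
apply/annL => v vL; have := contract_dual_wedge v a alpha.
rewrite aa contract0r (contract_alpha vL) wedge0r subr0 => /esym/eqP.
by rewrite scaler_eq0 => /orP[/eqP//|/eqP/alpha_neq0].
Qed.

Variables (n : nat) (e : n.-tuple V).
Hypothesis he : basis_of fullv e.
Local Notation tri x := (triangle1 h e x alpha).

Lemma triangle1P c x y : tri (c *: x + y) = c *: tri x + tri y.
Proof.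
rewrite /triangle1 /= scaler_sumr -big_split; apply: eq_bigr => i _ /=.
rewrite scaler_sumr -big_split; apply: eq_bigr => j _ /=.
by rewrite contractDr contractZr wedgeDl wedgeZl scalerDr !scalerA mulrC.
Qed.

Lemma triangle1_dual_wedge a b : (forall v, v \in L -> a v = 0) ->
  tri (wedge (of_dual a) (of_dual b)) = - b (sharp h a) *: alpha.
Proof.
move=> aL; rewrite /triangle1 /=; set G := invmx _.
have E i j : G i j *: wedge (contract (tnth e i) (wedge (of_dual a) (of_dual b)))
        (contract (tnth e j) alpha) =
    wedge (of_dual b) (contract ((G i j * a (tnth e i)) *: tnth e j) alpha) -
    wedge (of_dual a) (contract ((G i j * b (tnth e i)) *: tnth e j) alpha).
  rewrite contract_dual_wedge contract_of_dual wedgeZr wedgex1 wedgeDl wedgeNl.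
  by rewrite !wedgeZl !contractZl !wedgeZr -!scalerA scalerBr.
under eq_bigr do under eq_bigr do rewrite E.
under eq_bigr do rewrite sumrB -!wedge_sumr -!contract_suml.
rewrite sumrB -!wedge_sumr -!contract_suml !(sharp_gram hnd) //.
rewrite contract_alpha ?sharp_annihilator// wedge0r sub0r.
have := contract_dual_wedge (sharp h b) a alpha.
rewrite wedge_alpha// contract0r => /esym/eqP; rewrite subr_eq0 => /eqP <-.
by rewrite (sharp_swap hnd a b) scaleNr.
Qed.

(** The scalar by which a 2-form of the ideal generated by the annihilator of L
acts on xi is also, up to sign, its effect on alpha through [triangle1]: for
a /\ b with a vanishing on L, both are the pairing of b with the dual vector of
a. *)
Lemma act_triangle1_vanishing x : homogeneous 2 x ->
  (forall s, all (mem L) s -> eval x s = 0) ->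
  exists2 t : R, act x xi = t *: xi & tri x = - t *: alpha.
Proof.
apply: (annihilator_ind (P := fun x =>
  exists2 t : R, act x xi = t *: xi & tri x = - t *: alpha)).
  move=> c {}x y [t xt xT] [r yr yT]; exists (c * t + r).
    by rewrite actD actZ xt yr scalerA scalerDl.
  by rewrite triangle1P xT yT scalerA opprD mulrN scalerDl.
move=> a y aL /homogeneous1E[b ->]; exists (b (sharp h a)).
  by rewrite act_dual_wedge// contract_of_dual actZ act_one.
exact: triangle1_dual_wedge.
Qed.

Lemma contract_triangle1 v x : v \in L ->
  contract v (tri x) = - tri (contract v x).
Proof.
move=> vL; rewrite /triangle1 /= contract_sumr -sumrN; apply: eq_bigr => i _.
rewrite contract_sumr -sumrN; apply: eq_bigr => j _.
rewrite contractZr contract_wedge (contract_anticomm v (tnth e j)).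
rewrite (contract_alpha vL) contract0r oppr0 wedge0r addr0.
by rewrite contract_anticomm wedgeNl scalerN.
Qed.

Lemma homogeneous_triangle1 k l x : homogeneous k.+1 x -> homogeneous l.+1 alpha ->
  homogeneous (k + l) (tri x).
Proof.
move=> xk al; rewrite /triangle1 /=.
elim/big_ind: _ => // [y z|i _]; first exact: homogeneousD.
elim/big_ind: _ => // [y z|j _]; first exact: homogeneousD.
by apply/homogeneousZ/homogeneous_wedge; exact: homogeneous_contract.
Qed.

(** The difference of the two forms lives on V / L, whose dimension is smaller
than the degree. *)
Lemma eq_of_contractL k x y : (\dim {:V} - \dim L < k)%N ->
  homogeneous k x -> homogeneous k y ->
  (forall v, v \in L -> contract v x = contract v y) -> x = y.
Proof.
move=> dk xk yk xy; apply: extalg_eq => s.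
have [sk|/eqP sk] := eqVneq (size s) k; last by rewrite xk// yk.
apply/eqP; rewrite -subr_eq0 -evalN -evalD.
rewrite (@eval_transversal0 _ _ L) ?sk// => u uL.
by rewrite contractDr contractNr xy// subrr.
Qed.

Variables (phi : dual V) (H : extalg V).
Hypothesis hH : homogeneous 3 H.

Let H_contract u v w : contract w (contract v (contract u H)) =
  eval H [:: u; v; w] *: ext_one.
Proof.
by rewrite (homogeneous0E (x := contract w _)) //;
  do 3 apply: homogeneous_contract.
Qed.

Lemma vanishing3 :
  (forall u v w, u \in L -> v \in L -> w \in L -> eval H [:: u; v; w] = 0) ->
  forall s, all (mem L) s -> eval H s = 0.
Proof.
move=> HL s sL; have [|/eqP] := eqVneq (size s) 3%N; last exact: hH.
case: s sL => [|u [|v [|w []]]]//= /and4P[uL vL wL _] _.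
exact: HL.
Qed.

Hypothesis dimL : (\dim L + \dim L = \dim {:V})%N.
Hypothesis alphaL : homogeneous (\dim L) alpha.

Let codimL : (\dim {:V} - \dim L)%N = \dim L.
Proof. by rewrite -dimL addnK. Qed.

Lemma contract_wedge_alpha v x : v \in L ->
  contract v (wedge x alpha) = wedge (contract v x) alpha.
Proof. by move=> vL; rewrite contract_wedge contract_alpha// wedge0r addr0. Qed.

Lemma wedge_alpha_vanishing k x : homogeneous k x -> (0 < k)%N ->
  (forall v, v \in L -> wedge (contract v x) alpha = 0) -> wedge x alpha = 0.
Proof.
move=> xk k0 xL; apply: (@eq_of_contractL (k + \dim L)) => //.
- by rewrite codimL -[X in (X < _)%N]add0n ltn_add2r.
- exact: homogeneous_wedge.
- by move=> v vL; rewrite contract0r contract_wedge_alpha ?xL.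
Qed.

(** Contracting three times with vectors of L turns H /\ alpha into a value of H
times alpha.  In the other direction each contraction with L may be undone, as
the degree stays larger than the dimension of V / L. *)
Lemma wedge_alpha3P : wedge H alpha = 0 <->
  forall s, all (mem L) s -> eval H s = 0.
Proof.
split=> [Ha|HL].
  apply: vanishing3 => u v w uL vL wL.
  have := H_contract u v w => /(congr1 (fun x => wedge x alpha)).
  rewrite -!contract_wedge_alpha// Ha !contract0r wedgeZl wedge1x => /esym/eqP.
  by rewrite scaler_eq0 => /orP[/eqP//|/eqP/alpha_neq0].
have Hc := @homogeneous_contract R V.
apply: (wedge_alpha_vanishing hH) => // u uL.
apply: (wedge_alpha_vanishing (Hc _ _ _ hH)) => // v vL.
apply: (wedge_alpha_vanishing (Hc _ _ _ (Hc _ _ _ hH))) => // w wL.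
by rewrite H_contract HL ?scale0r ?wedge0l //= uL vL wL.
Qed.

(** After contraction with v in L the two sides become phi(v) alpha and t alpha,
where t is the scalar by which i_v H acts on xi. *)
Lemma wedge_triangle1P : (0 < \dim L)%N ->
  (forall s, all (mem L) s -> eval H s = 0) ->
  wedge (of_dual phi) alpha = tri H <->
  forall v, v \in L -> act (contract v H) xi = phi v *: xi.
Proof.
move=> dL HL.
have HcL v : v \in L -> forall s, all (mem L) s -> eval (contract v H) s = 0.
  by move=> vL s sL; rewrite eval_contract HL //= vL.
have E v : v \in L -> exists2 t : R, act (contract v H) xi = t *: xi &
    contract v (tri H) = t *: alpha.
  move=> vL; have [t tE tT] :=
    act_triangle1_vanishing (homogeneous_contract v hH) (HcL v vL).
  by exists t => //; rewrite contract_triangle1// tT scaleNr opprK.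
have C v : v \in L -> contract v (wedge (of_dual phi) alpha) = phi v *: alpha.
  by move=> vL; rewrite contract_dual_wedge contract_alpha// wedge0r subr0.
split=> [pT v vL|pT].
  have [t -> tT] := E v vL; congr (_ *: _).
  move: tT; rewrite -pT C// => /eqP; rewrite -subr_eq0 -scalerBl scaler_eq0 subr_eq0.
  by move=> /orP[/eqP ->//|/eqP/alpha_neq0].
have aL' : homogeneous (\dim L).-1.+1 alpha by rewrite prednK.
apply: (@eq_of_contractL (1 + \dim L)).
- by rewrite codimL.
- exact/homogeneous_wedge/alphaL/homogeneous_of_dual.
- have := homogeneous_triangle1 hH aL'.
  by rewrite addSn -addnS prednK.
move=> v vL; rewrite C//; have [t tE ->] := E v vL; congr (_ *: _).
move: (pT v vL); rewrite tE => /eqP; rewrite -subr_eq0 -scalerBl scaler_eq0 subr_eq0.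
by move=> /orP[/eqP ->//|/eqP/xi_neq0].
Qed.

(** Acting once, then three times, with vectors of L on phi.xi = H.xi gives the
two conditions.  Conversely H acts on xi as a covector, by [act_vanishing], and
the second condition says that this covector agrees with phi on L. *)
Lemma act_eqP : act (of_dual phi) xi = act H xi <->
  (forall s, all (mem L) s -> eval H s = 0) /\
  forall v, v \in L -> act (contract v H) xi = phi v *: xi.
Proof.
split=> [pH|[HL Hp]].
  have Hv v : v \in L -> act (contract v H) xi = phi v *: xi.
    move=> vL; apply: twice_inj; rewrite -act_act// -pH act_act//.
    by rewrite contract_of_dual actZ act_one.
  split=> //; apply: vanishing3 => u v w uL vL wL.
  have : act (contract w (contract v (contract u H))) xi = 0.
    apply: twice_inj; rewrite -act_act// scaler0 -[RHS](act0r (of_dual (flat h w))).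
    congr (act _ _); apply: twice_inj; rewrite -act_act// scaler0 Hv// actZr.
    by move/memL: vL => ->; rewrite scaler0.
  by rewrite H_contract actZ act_one => /eqP; rewrite scaler_eq0 => /orP[/eqP//|/eqP].
have [_ /homogeneous1E[a ->] HE] := act_vanishing hH HL.
rewrite HE; apply/eqP; rewrite -subr_eq0 -actN -actD -linearB; apply/eqP.
apply/annL => v vL; rewrite add_lfunE opp_lfunE.
apply/eqP; rewrite subr_eq0; apply/eqP.
have : act (contract v (of_dual a)) xi = phi v *: xi.
  by apply: twice_inj; rewrite -act_act// -HE act_act// Hp.
rewrite contract_of_dual actZ act_one => /eqP.
by rewrite -subr_eq0 -scalerBl scaler_eq0 subr_eq0 => /orP[/eqP ->//|/eqP/xi_neq0].
Qed.

Lemma act_eq_wedge_triangle1P : (0 < \dim L)%N ->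
  act (of_dual phi) xi = act H xi <->
  wedge H alpha = 0 /\ wedge (of_dual phi) alpha = tri H.
Proof.
move=> dL; rewrite act_eqP wedge_alpha3P.
by split=> -[HL]; [move/(wedge_triangle1P dL HL)|move/(wedge_triangle1P dL HL)].
Qed.

End SignedSquare.
End PureSpinor.
End SpinorAction.

(** * Decomposable forms *)

Section WedgeFamily.
Context {R : realType} {V : vectType R}.
Implicit Types (x y z : extalg V) (u v w : V) (a b : dual V).

Lemma codom_ordSl (T : Type) k (v : 'I_k.+1 -> T) :
  codom v = v ord0 :: codom (v \o lift ord0).
Proof. by rewrite !codomE enum_ordSl /= -map_comp. Qed.

Lemma codom_tuple_tnth (T : Type) k (t : k.-tuple T) : codom (tnth t) = t.
Proof. by rewrite codomE map_tnth_enum. Qed.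

Lemma eval_dual_wedge k a x (v : 'I_k -> V) :
  eval (wedge (of_dual a) x) (codom v) =
  \sum_(j < k) (-1) ^+ j * a (v j) * eval x (codom (v \o lift j)).
Proof.
elim: k x v => [|k IH] x v.
  by rewrite big_ord0 codomE enum_ord0 eval_dual_wedge_nil.
rewrite codom_ordSl -eval_contract contract_dual_wedge evalD evalN evalZ IH.
rewrite big_ord_recl expr0 mul1r; congr (_ + _).
rewrite -sumrN; apply: eq_bigr => -[j jk] _; rewrite exprS mulN1r !mulNr.
congr (- (_ * _)); rewrite eval_contract; congr (eval x _).
case: k => [//|k] in IH v j jk *.
rewrite [RHS]codom_ordSl; congr (_ :: _).
  by congr (v _); apply: val_inj.
by apply: eq_codom => i /=; congr (v _); apply: val_inj; rewrite /= /bump /=; lia.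
Qed.

Lemma wedge_family0 (th : 'I_0 -> dual V) : wedge_family th = ext_one.
Proof. by rewrite /wedge_family big_ord0. Qed.

Lemma wedge_familyS k (th : 'I_k.+1 -> dual V) :
  wedge_family th = wedge (of_dual (th ord0)) (wedge_family (th \o lift ord0)).
Proof. by rewrite /wedge_family big_ord_recl. Qed.

Lemma homogeneous_wedge_family k (th : 'I_k -> dual V) :
  homogeneous k (wedge_family th).
Proof.
elim: k th => [|k IH] th; first by rewrite wedge_family0 => -[].
rewrite wedge_familyS.
exact: (homogeneous_wedge (@homogeneous_of_dual _ _ _) (IH _)).
Qed.

Lemma eval_wedge_family k (th : 'I_k -> dual V) (v : 'I_k -> V) :
  eval (wedge_family th) (codom v) = \det (\matrix_(i, j) th i (v j)).
Proof.
elim: k th v => [|k IH] th v.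
  by rewrite wedge_family0 det_mx00 codomE enum_ord0.
rewrite wedge_familyS eval_dual_wedge (expand_det_row _ ord0).
apply: eq_bigr => j _; rewrite IH /cofactor mxE add0n mulrCA mulrA.
by congr (_ * \det _); apply/matrixP => i l; rewrite !mxE.
Qed.

Lemma wedge_family_ind k (P : extalg V -> Prop) :
  (forall c x y, P x -> P y -> P (c *: x + y)) ->
  (forall th : 'I_k -> dual V, P (wedge_family th)) ->
  forall x, homogeneous k x -> P x.
Proof.
have [r [f rf]] := @basis_resolution R V.
have zeroP m (Q : extalg V -> Prop) :
    (forall c x y, Q x -> Q y -> Q (c *: x + y)) ->
    (forall th : 'I_m -> dual V, Q (wedge_family th)) -> Q 0.
  move=> Ql Qw; have Q0 := Qw (fun=> 0).
  by have := Ql (-1) _ _ Q0 Q0; rewrite scaleN1r addNr.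
elim: k P => [|k IH] P Pl Pw x xk; have P0 := zeroP _ P Pl Pw.
  rewrite (homogeneous0E xk) -[_ *: _]addr0 -(wedge_family0 (fun=> 0)).
  exact: (Pl).
rewrite -[x]scale1r -(mulVf (_ : k.+1%:R != 0)) ?pnatr_eq0//.
rewrite -scalerA -(homogeneous_wedge_contract_sum rf xk) -[_ *: _]addr0.
apply: (Pl) => //; elim/big_ind: _ => // [y z Py Pz|i _].
  by rewrite -[y]scale1r; exact: (Pl).
apply: (IH (fun y => P (wedge (of_dual (r i)) y))).
- by move=> c y z Py Pz; rewrite wedgeDr wedgeZr; exact: (Pl).
- move=> th; have := Pw (fun j => if unlift ord0 j is Some j' then th j' else r i).
  rewrite wedge_familyS unlift_none; congr (P (wedge _ _)).
  by rewrite /wedge_family; apply: eq_bigr => j _; rewrite /= liftK.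
- exact: homogeneous_contract.
Qed.

Lemma grading_homogeneous k x : homogeneous k x -> grading x = (-1) ^+ k *: x.
Proof.
move=> xk; apply: extalg_eq => s; rewrite evalZ /=.
by have [->//|/eqP sk] := eqVneq (size s) k; rewrite xk // !mulr0.
Qed.

End WedgeFamily.

(** * The induced metric and the Hodge star *)

Section Hodge.
Context {R : realType} {V : vectType R} (h : {symmetric V}).
Hypothesis hnd : forall u, (forall w, h u w = 0) -> u = 0.
Variable g : {symmetric (extalg V)}.
Hypothesis hg : induced_metric h g.
Variables (nu : extalg V) (star : {linear extalg V -> extalg V}).
Hypothesis nun : homogeneous (\dim {:V}) nu.
Hypothesis hstar : hodge_star g nu star.
Implicit Types (x y z : extalg V) (u v w : V) (a b : dual V).

(** On decomposable forms both sides are the same determinant, up to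
transposition. *)
Lemma metric_flat_family k (v : 'I_k -> V) x : homogeneous k x ->
  g (wedge_family (flat h \o v)) x = eval x (codom v).
Proof.
apply: (wedge_family_ind (P := fun x =>
  g (wedge_family (flat h \o v)) x = eval x (codom v))) => [c {}x y IHx IHy|th].
  by rewrite linearPr /= IHx IHy.
rewrite hg.1 eval_wedge_family -[RHS]det_tr; congr (\det _).
by apply/matrixP => i j; rewrite !mxE /hdual flatK// symmetricC sharpE.
Qed.

(** Let b be the exterior product of the covectors dual to the arguments of x.
The Hodge star says that b /\ a = x(...) nu; pairing both sides with nu gives
x(...) g(nu, nu) on one side and a value of the contraction of nu on the other,
with the sign of moving a to the front of b. *)
Lemma star_hyperform k x a : \dim {:V} = k.+1 -> homogeneous k x ->
  star x = of_dual a ->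
  g nu nu *: x = (-1) ^+ k *: contract (sharp h a) nu.
Proof.
move=> dk xk xa; apply: extalg_eq => s; rewrite !evalZ eval_contract.
have [sk|/eqP sk] := eqVneq (size s) k; last first.
  by rewrite xk// (nun (s := _ :: s)) ?mulr0//= dk => -[].
pose t := Tuple (introT eqP sk); pose v := tnth t.
have sv : codom v = s by rewrite codom_tuple_tnth.
pose v' (i : 'I_k.+1) := if unlift ord0 i is Some j then v j else sharp h a.
have v's : codom v' = sharp h a :: s.
  rewrite codom_ordSl /v' unlift_none -sv; congr (_ :: _).
  by apply: eq_codom => i; rewrite /= liftK.
have Fv' : wedge_family (flat h \o v') =
    wedge (of_dual a) (wedge_family (flat h \o v)).
  rewrite wedge_familyS /= /v' unlift_none (sharpK hnd); congr (wedge _ _).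
  by rewrite /wedge_family; apply: eq_bigr => i _; rewrite /= liftK.
have dk' : (k <= \dim {:V})%N by rewrite dk leqW.
have [_ /(_ _ (homogeneous_wedge_family (flat h \o v)))] := hstar dk' xk.
rewrite xa wedge_of_dualC (grading_homogeneous (homogeneous_wedge_family _)).
rewrite metric_flat_family// sv wedgeZr -Fv' => /(congr1 (fun z => g z nu)).
rewrite !linearZl_LR /= metric_flat_family -?dk// v's => ->.
by rewrite mulrC.
Qed.

(** The star of nu is a scalar r.  Pairing with nu itself shows r = g(nu, nu), and
pairing with the exterior product of the covectors dual to e shows that r times
the Gram determinant is 1. *)
Lemma metric_volume (c : R) n (e : n.-tuple V) :
  basis_of fullv e -> eval nu e = 1 ->
  \det (\matrix_(i < n, j < n) h (tnth e i) (tnth e j)) = c -> c * c = 1 ->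
  g nu nu = c.
Proof.
move=> eb nue hc cc.
have dn : \dim {:V} = n by rewrite -(size_basis eb).
have [star0 starP] := hstar (leqnn (\dim {:V})) nun.
rewrite subnn in star0; have starE := homogeneous0E star0.
set r := eval _ [::] in starE.
have nuE : nu <> 0 by move=> nu0; move: nue; rewrite nu0 => /esym/eqP; rewrite oner_eq0.
have -> : g nu nu = r.
  have := starP nu nun; rewrite starE wedgeZr wedgex1 => /eqP.
  by rewrite -subr_eq0 -scalerBl scaler_eq0 subr_eq0 => /orP[/eqP ->//|/eqP/nuE].
have nun' : homogeneous n nu by rewrite -dn.
rewrite dn in starP.
have := starP _ (homogeneous_wedge_family (flat h \o tnth e)).
rewrite metric_flat_family// codom_tuple_tnth nue starE wedgeZr wedgex1 scale1r.
move=> /(congr1 (fun z => eval z e)); rewrite evalZ nue -(codom_tuple_tnth e).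
rewrite eval_wedge_family.
have -> : \matrix_(i, j) (flat h \o tnth e) i (tnth e j) =
  \matrix_(i < n, j < n) h (tnth e i) (tnth e j).
  by apply/matrixP => i j; rewrite !mxE /= flatE.
by rewrite hc => rc; rewrite -[r]mulr1 -cc mulrA rc mul1r.
Qed.
End Hodge.

(** * Orthonormal bases *)

Section Bases.
Context {R : realType} {V : vectType R} (h : {symmetric V}).
Implicit Types (u v w : V) (a b : dual V).

Lemma orthogonal_free n (e : n.-tuple V) :
  (forall i j : 'I_n, i != j -> h (tnth e i) (tnth e j) = 0) ->
  (forall i : 'I_n, h (tnth e i) (tnth e i) != 0) -> free e.
Proof.
move=> eo en; apply/freeP => k k0 j.
have := congr1 (fun z => h z (tnth e j)) k0; rewrite linear0l linear_sumlz /=.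
rewrite (bigD1 j)//= big1 => [|i ij]; rewrite linearZl_LR /= -tnth_nth.
  by rewrite addr0 => /eqP; rewrite mulf_eq0 (negPf (en j)) orbF => /eqP.
by rewrite eo// mulr0.
Qed.

Lemma orthonormal_nondegenerate n (e : n.-tuple V) : orthonormal_basis h e ->
  forall u, (forall w, h u w = 0) -> u = 0.
Proof.
move=> [eb eo en] u u0; rewrite (coord_basis eb (memvf u)) big1 // => j _.
have := u0 (tnth e j); rewrite {1}(coord_basis eb (memvf u)) linear_sumlz /=.
rewrite (bigD1 j)//= big1 => [|i ij]; rewrite linearZl_LR /= -tnth_nth.
  rewrite addr0 => /eqP; rewrite mulf_eq0 => /orP[/eqP ->|]; first by rewrite scale0r.
  by have [->|->] := en j; rewrite ?oppr_eq0 oner_eq0.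
by rewrite eo// mulr0.
Qed.

Lemma det_coord_neq0 n (o e : n.-tuple V) : basis_of fullv o ->
  basis_of fullv e -> \det (\matrix_(i < n, j < n) coord o j (tnth e i)) != 0.
Proof.
move=> ob eb; set M := \matrix_(i, j) _.
have oE v : v = \sum_i coord o i v *: o`_i by exact: coord_basis ob (memvf v).
rewrite -unitfE -[_ \is a _]/(M \in unitmx) -row_free_unit.
apply: inj_row_free => c cM; apply/rowP => i; rewrite mxE.
have /freeP := basis_free eb; apply; rewrite (oE (\sum_j _)) big1 // => j _.
rewrite linear_sum /= (_ : \sum_k _ = 0) ?scale0r//.
have := congr1 (fun N : 'rV_n => N 0 j) cM; rewrite !mxE => cMj; rewrite -[RHS]cMj.
by apply: eq_bigr => k _; rewrite linearZ /= mxE (tnth_nth 0).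
Qed.

(** If e is negatively oriented, its vector of index i0 is replaced by the
opposite one. *)
Lemma oriented_orthonormal n (o e : n.-tuple V) (i0 : 'I_n) :
  basis_of fullv o -> orthonormal_basis h e ->
  exists e' : n.-tuple V, [/\ orthonormal_basis h e', positively_oriented o e' &
    forall i, h (tnth e' i) (tnth e' i) = h (tnth e i) (tnth e i)].
Proof.
move=> ob [eb eo en].
have := det_coord_neq0 ob eb; rewrite neq_lt => /orP[M0|]; last by exists e.
pose s (i : 'I_n) : R := (-1) ^+ (i == i0).
have ss i : s i * s i = 1 by rewrite -expr2 sqrr_sign.
pose e' := [tuple s i *: tnth e i | i < n].
have e'E i : tnth e' i = s i *: tnth e i by rewrite tnth_mktuple.
have e'h i j : h (tnth e' i) (tnth e' j) = s i * s j * h (tnth e i) (tnth e j).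
  by rewrite !e'E linearZl_LR linearZr_LR /= mulrA.
exists e'; split=> [||i]; last by rewrite e'h ss mul1r.
- have e'o (i j : 'I_n) : i != j -> h (tnth e' i) (tnth e' j) = 0.
    by move=> ij; rewrite e'h eo// mulr0.
  have e'n i : h (tnth e' i) (tnth e' i) = 1 \/ h (tnth e' i) (tnth e' i) = -1.
    by rewrite e'h ss mul1r.
  have dn : \dim {:V} = n by rewrite -(size_basis eb).
  split=> //; rewrite basisEfree subvf size_tuple dn leqnn !andbT.
  apply: orthogonal_free => // i.
  by have [->|->] := e'n i; rewrite ?oppr_eq0 oner_eq0.
rewrite /positively_oriented.
have -> : \matrix_(i < n, j < n) coord o j (tnth e' i) =
    diag_mx (\row_i s i) *m \matrix_(i < n, j < n) coord o j (tnth e i).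
  by apply/matrixP => i j; rewrite mul_diag_mx !mxE e'E linearZ.
rewrite det_mulmx det_diag (bigD1 i0)//= big1 => [|i ii0]; rewrite mxE /s.
  by rewrite eqxx mulr1 mulN1r oppr_gt0.
by rewrite (negPf ii0).
Qed.

Lemma det_gram_orthogonal n (e : n.-tuple V) :
  (forall i j : 'I_n, i != j -> h (tnth e i) (tnth e j) = 0) ->
  \det (\matrix_(i < n, j < n) h (tnth e i) (tnth e j)) =
  \prod_i h (tnth e i) (tnth e i).
Proof.
move=> eo; have -> : \matrix_(i < n, j < n) h (tnth e i) (tnth e j) =
    diag_mx (\row_i h (tnth e i) (tnth e i)).
  apply/matrixP => i j; rewrite !mxE.
  by have [->|ij] := eqVneq i j; rewrite ?mulr1n// eo.
by rewrite det_diag; apply: eq_bigr => i _; rewrite mxE.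
Qed.

End Bases.

(** * Lagrangian subspaces *)

Section NullSpace.
Context {R : realType} {V : vectType R} (h : {symmetric V}).
Hypothesis hnd : forall u, (forall w, h u w = 0) -> u = 0.
Implicit Types (u v w : V) (a b : dual V).

Lemma sharp_space (N : {vspace dual V}) : exists L : {vspace V},
  \dim L = \dim N /\ forall v, v \in L <-> flat h v \in N.
Proof.
pose f := ((linfun (flat h))^-1)%VF.
exists (f @: N)%VS; split=> [|v].
  apply: limg_dim_eq; apply/eqP; rewrite -subv0; apply/subvP => a.
  rewrite memv_cap memv_ker => /andP[_ /eqP fa]; rewrite memv0.
  by rewrite -(sharpK hnd a) -[sharp h a]/(f a) fa linear0.
split=> [/memv_imgP[a aN ->]|vN]; first by rewrite -[f a]/(sharp h a) sharpK.
by apply/memv_imgP; exists (flat h v) => //; rewrite -[LHS](flatK hnd).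
Qed.

(** N is contained in the annihilator of L, which is spanned by dim V - dim L
covectors, and this number is the dimension of N. *)
Lemma annihilator_eq (L : {vspace V}) (N : {vspace dual V}) :
  (\dim L + \dim N = \dim {:V})%N ->
  (forall a v, a \in N -> v \in L -> a v = 0) ->
  forall a, (forall v, v \in L -> a v = 0) -> a \in N.
Proof.
move=> dLN NL a aL.
have [l [lam [c [rho [lL rhoL res]]]]] := adapted_resolution L.
have span b : (forall v, v \in L -> b v = 0) -> b \in <<codom rho>>%VS.
  move=> bL; have -> : b = \sum_j b (c j) *: rho j.
    apply/lfunP => v; rewrite -{1}(res v) linearD !linear_sum /= big1 => [|i _].
      rewrite add0r sum_lfunE; apply: eq_bigr => j _.
      by rewrite linearZ /= scale_lfunE [LHS]mulrC.
    by rewrite linearZ /= bL ?scaler0.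
  by apply: rpred_sum => j _; apply/rpredZ/memv_span/codom_f.
have Nrho : (N <= <<codom rho>>)%VS.
  by apply/subvP => b bN; apply: span => v; exact: NL.
suff /eqP -> : N == <<codom rho>>%VS by exact: span.
rewrite eqEdim Nrho (leq_trans (dim_span _))// size_codom card_ord.
by rewrite -dLN addKn.
Qed.

End NullSpace.

Lemma homogeneous_addr_eq0 (R : realType) (V : vectType R) k l (x y : extalg V) :
  k <> l -> homogeneous k x -> homogeneous l y -> x + y = 0 -> x = 0 /\ y = 0.
Proof.
move=> kl xk yl xy.
suff x0 : x = 0 by split=> //; rewrite -xy x0 add0r.
apply: extalg_eq => s; have [sk|/eqP sk] := eqVneq (size s) k; last exact: xk.
by rewrite -[RHS]/(eval 0 s) -xy evalD (yl s) ?addr0// sk.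
Qed.

(** * Pure spinors and 3-forms *)

Theorem proposition3p16 (R : realType) (p : nat) (hp : (2 <= p)%N)
  (* the oriented quadratic space (V, h) *)
  (V : vectType R) (h : {symmetric V}) (hsig : has_signature h p p)
  (o : (p + p).-tuple V) (ho : basis_of fullv o)
  (nu : extalg V) (hnu : volume_form h o nu)
  (g : {symmetric (extalg V)}) (hg : induced_metric h g)
  (star : {linear extalg V -> extalg V}) (hstar : hodge_star g nu star)
  (e : (p + p).-tuple V) (he : basis_of fullv e)
  (* the Clifford algebra of the dual space and the Chevalley-Riesz isomorphism *)
  (Cl : algType R) (cl : {linear dual V -> Cl}) (hcl : clifford_algebra h cl)
  (gp : {bilinear extalg V -> extalg V -> extalg V})
  (hgp : geometric_product h gp)
  (Psi : {linear extalg V -> Cl}) (hPsi : chevalley_riesz gp cl Psi)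
  (par : {lrmorphism Cl -> Cl}) (hpar : parity_automorphism cl par)
  (rev : {linear Cl -> Cl}) (hrev : reversion cl rev)
  (* the irreducible module and its admissible pairing *)
  (S : vectType R) (gam : {linear Cl -> 'End(S)})
  (hgam : irreducible_module gam)
  (B : {biscalar S}) (hB : admissible_pairing gam par rev B)
  (* the pure spinor xi of chirality mu and its signed square alpha *)
  (mu : R) (hmu : mu = 1 \/ mu = -1)
  (xi : S) (hxi : pure_spinor cl gam p xi)
  (hchi : has_chirality gam Psi nu mu xi)
  (kappa : R) (hkappa : kappa = 1 \/ kappa = -1)
  (th : 'I_p -> dual V) (alpha : extalg V) (halpha : alpha = wedge_family th)
  (hsq : signed_square gam Psi B kappa xi alpha)
  (phi : dual V) (H : extalg V) (hH : homogeneous 3 H) :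
  ((3 <= p)%N ->
     (clifford_action gam Psi (of_dual phi) xi = clifford_action gam Psi H xi <->
      wedge H alpha = 0 /\
      wedge (of_dual phi) alpha = triangle1 h e H alpha)) /\
  (p = 2%N ->
     (clifford_action gam Psi (of_dual phi) xi = clifford_action gam Psi H xi <->
      wedge (of_dual phi + mu *: star H) alpha = 0)).
Proof.
have [f [fo fs]] := hsig; have [fb fO _] := fo.
have hnd := orthonormal_nondegenerate fo.
have dV : \dim {:V} = (p + p)%N by rewrite -(size_basis he).
have [lm _ _] := hgam; have [xi0 [N [dN memN]]] := hxi.
have [L [dLN LN]] := sharp_space hnd N.
have actE := act_of_dual hPsi gam.
(* N is isotropic: the Clifford anticommutator of two of its members kills xi. *)
have NL (a : dual V) v : a \in N -> v \in L -> a v = 0.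
  move=> aN /LN vN.
  have := gp_supercommutator hnd hgp (flat h v) (of_dual a).
  move=> /(congr1 (fun x => clifford_action gam Psi x xi)).
  rewrite grading_of_dual linearNl opprK actD actZ !(act_gp hPsi lm) !actE.
  rewrite (memN a).1// (memN _).1// !linear0 addr0 flatK// contract_of_dual actZ.
  rewrite (act_one hPsi lm) scalerA => /esym/eqP; rewrite scaler_eq0 mulf_eq0.
  by rewrite pnatr_eq0 /= => /orP[/eqP//|/eqP/xi0].
have dL : \dim L = p by rewrite dLN.
have dLL : (\dim L + \dim L = \dim {:V})%N by rewrite dL dV.
have memL v : v \in L <-> clifford_action gam Psi (of_dual (flat h v)) xi = 0.
  by rewrite actE -memN.
have annL (a : dual V) : (forall v, v \in L -> a v = 0) <->
    clifford_action gam Psi (of_dual a) xi = 0.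
  rewrite actE -memN; split=> [aL|aN v]; last exact: NL.
  by apply: (annihilator_eq _ NL) aL; rewrite dL dN dV.
have alphap : homogeneous p alpha by rewrite halpha; exact: homogeneous_wedge_family.
(* The pairing is non-degenerate, so some spinor pairs non-trivially with xi. *)
have alpha0 : alpha <> 0.
  move=> a0; have [Bnd Bs _] := hB; apply/xi0/Bnd => zeta.
  have B0 : B zeta xi = 0.
    have := hsq zeta; rewrite a0 !linear0 lfunE /= => /esym/eqP.
    rewrite !scaler_eq0 => /orP[|/orP[/eqP//|/eqP/xi0//]].
    by case: hkappa => ->; rewrite ?oppr_eq0 oner_eq0.
  by case: Bs => ->; rewrite B0 ?oppr0.
have gpalpha (a : dual V) : (forall v, v \in L -> a v = 0) ->
    wedge (of_dual a) alpha = 0 /\ contract (sharp h a) alpha = 0.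
  move=> /annL aL; have [_ _ _ gpE] := hgp.
  have alphap' : homogeneous p.-1.+1 alpha by rewrite prednK// ltnW.
  (* alpha acts with values in the line of xi, which a kills. *)
  have gp0 : gp (of_dual a) alpha = 0.
    apply: (act_faithful hnd hgp hPsi lm (c := - (-1) ^+ p) xi0) => [|zeta].
      rewrite (grading_gp_dual hgp) (grading_homogeneous alphap).
      by rewrite linearZr_LR /= scaleNr.
    rewrite (act_gp hPsi lm) /clifford_action hsq !linearZ /=.
    by rewrite -[gam _ xi]/(clifford_action gam Psi (of_dual a) xi) aL !scaler0.
  (* The exterior product and the contraction lie in degrees p + 1 and p - 1. *)
  apply: (@homogeneous_addr_eq0 _ _ p.+1 p.-1) => //; first by lia.
  - exact: (homogeneous_wedge (@homogeneous_of_dual _ _ a) alphap).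
  - exact: homogeneous_contract.
  - by rewrite -gpE.
have wedgea a aL := (gpalpha a aL).1.
have contra v : v \in L -> contract v alpha = 0.
  move=> vL; rewrite -(flatK hnd v); apply: (gpalpha _ _).2 => w wL.
  by apply: NL => //; exact/LN.
split=> [p3|].
  apply: (act_eq_wedge_triangle1P hnd hgp hPsi lm xi0 memL annL) => //.
    by rewrite dL.
  by rewrite dL; lia.
move=> p2; have dV4 : \dim {:V} = 4%N by rewrite dV p2.
have i0 : 'I_(p + p) by rewrite p2; exact: ord0.
have [o' [o'o o'pos o'h]] := oriented_orthonormal i0 ho fo.
have [nup nu1] := hnu; have [o'b o'O _] := o'o.
have nud : homogeneous (\dim {:V}) nu by rewrite dV.
have gnu : g nu nu = 1.
  apply: (metric_volume hnd hg nud hstar o'b); rewrite ?mulr1//; first exact: nu1.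
  rewrite det_gram_orthogonal//; under eq_bigr do rewrite o'h fs.
  rewrite big_split_ord /= big1 => [|i _]; last by rewrite leqNgt ltn_ord.
  under eq_bigr do rewrite leq_addr expr1.
  by rewrite prodr_const card_ord p2 mul1r -signr_odd.
have dV3 : (3 <= \dim {:V})%N by rewrite dV4.
have [star1 _] := hstar 3%N H dV3 hH.
rewrite dV4 in star1; have [eta starE] := homogeneous1E star1.
have HE : H = - contract (sharp h eta) nu.
  have := star_hyperform hnd hg nud hstar dV4 hH starE.
  by rewrite gnu scale1r => ->; rewrite -signr_odd expr1 scaleN1r.
have actH : clifford_action gam Psi H xi =
    - (mu *: clifford_action gam Psi (of_dual eta) xi).
  have [_ _ _ gpE] := hgp.
  have -> : H = - gp (of_dual eta) nu.
    (* The exterior product of eta and nu has degree 5 in dimension 4. *)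
    rewrite HE gpE [wedge _ _](_ : _ = 0) ?add0r//.
    apply: extalg_eq => s; have [s5|/eqP s5] := eqVneq (size s) 5%N.
      by rewrite eval_oversize// dV4 s5.
    by rewrite (homogeneous_wedge (@homogeneous_of_dual _ _ eta) nup)// p2.
  by rewrite actN (act_gp hPsi lm) hchi /clifford_action linearZ.
rewrite starE -linearZ -linearD.
rewrite (dual_wedge_alphaP annL alpha0 wedgea contra) linearD linearZ actD actZ actH.
split=> [->|/eqP]; first by rewrite addNr.
by rewrite addr_eq0 => /eqP.
Qed.
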